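(* Let $K_{[\mathrm{Id}]}$ denote the cut locus from $[\mathrm{Id}]$ of the sub-Riemannian manifold $L(4,1)=SU(2)/\!\approx$ (with the sub-Riemannian structure induced from the $\mathbf{k}\oplus\mathbf{p}$ structure on $SU(2)$, as described in the context). Then $K_{[\mathrm{Id}]}=K^{loc}\cup K^{sym}$, where $$K^{loc}=\{[e^{tk}]\ :\ t\in\mathbb{R}\}\setminus\{[\mathrm{Id}]\},$$ $$K^{sym}=\Big\{[g]\in L(4,1)\ :\ \text{for a fixed } g^*\in[g]\ \exists\, x_1,x_2\in[\mathrm{Id}],\ x_1\neq x_2,\ \text{such that } \forall x^*\in[\mathrm{Id}]:\ d(g^*,x_1)=d(g^*,x_2)\le d(g^*,x^* )\Big\},$$ and $d$ is the sub-Riemannian (Carnot–Carathéodory) distance on $SU(2)$. (Here $[h]$ denotes the $\approx$-class of $h\in SU(2)$.)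
   Context: $SU(2)=\left\{\begin{pmatrix}\alpha&\beta\\-\bar\beta&\bar\alpha\end{pmatrix}:\alpha,\beta\in\mathbb{C},\ |\alpha|^2+|\beta|^2=1\right\}$. Let $p_1=\frac12\begin{pmatrix}0&1\\-1&0\end{pmatrix}$, $p_2=\frac12\begin{pmatrix}0&i\\i&0\end{pmatrix}$, $k=\frac12\begin{pmatrix}i&0\\0&-i\end{pmatrix}$, $\mathbf{p}=\mathrm{span}\{p_1,p_2\}$, and let $\langle\cdot,\cdot\rangle$ be the inner product on $\mathbf{p}$ for which $p_1,p_2$ are orthonormal. The $\mathbf{k}\oplus\mathbf{p}$ sub-Riemannian structure on $SU(2)$ is the distribution $\Delta(g)=g\mathbf{p}$ with metric $\mathbf{g}_g(v,w)=\langle g^{-1}v,g^{-1}w\rangle$; horizontal curves are Lipschitz curves with velocity a.e. in $\Delta$, their length is $\int\sqrt{\mathbf{g}(\dot\gamma,\dot\gamma)}\,dt$, and $d(g,h)$ is the infimum of lengths of horizontal curves joining $g$ to $h$. Every $g\in SU(2)$ can be written $g=e^{-bp_2}e^{ap_1}e^{cp_2}$ with $a\in[0,\pi]$, $b\in[0,2\pi)$, $c\in\mathbb{R}/4\pi$. Define $g_1\approx g_2$ iff there exist such representations $g_1=e^{-b_1p_2}e^{a_1p_1}e^{c_1p_2}$, $g_2=e^{-b_2p_2}e^{a_2p_1}e^{c_2p_2}$ with $a_1=a_2$, $b_1=b_2$, $c_1\equiv c_2 \bmod \pi$. The quotient $L(4,1)=SU(2)/\!\approx$, with quotient map $\Pi$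 (a local diffeomorphism), carries the sub-Riemannian structure with distribution $\Pi_*(\Delta(h))$ at $[h]$ and metric induced by $\mathbf{g}$ via $\Pi_*$ (well defined independently of the representative $h$); lengths and distance $\hat d$ on $L(4,1)$ are defined as on $SU(2)$. The cut locus $K_{[\mathrm{Id}]}$ is the set of points $q\in L(4,1)$ for which there exist two distinct geodesics parametrized by arclength starting from $[\mathrm{Id}]$ which both reach $q$ at the same time $t>0$ and are both length-minimizing on $[0,t]$. *)

(* Defs.v *)
(* MathComp + MathComp-Analysis, over an abstract R : realType.       *)
From mathcomp Require Import all_boot all_order all_algebra.
From mathcomp Require Import all_classical all_reals all_analysis.
From mathcomp Require Import complex.

Set Implicit Arguments.
Unset Strict Implicit.
Unset Printing Implicit Defensive.

Import Order.TTheory GRing.Theory Num.Theory.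
Local Open Scope classical_set_scope.
Local Open Scope ring_scope.

Section SubRiemannianL41.
Variable R : realType.

Local Notation C := (R[i]).

(* 2x2 complex matrix [[a, b], [c, d]] *)
Definition mx2 (a b c d : C) : 'M[C]_2 :=
  \matrix_(i < 2, j < 2)
    if (i : nat) == 0%N then (if (j : nat) == 0%N then a else b)
    else (if (j : nat) == 0%N then c else d).

(* Realification: a 2x2 complex matrix M is represented by the 4x4 real
   matrix obtained by replacing each entry x + iy by the block [[x,-y],[y,x]].
   This is an injective, continuous, unital R-algebra morphism, so SU(2),
   its Lie algebra, products, inverses and exponentials are faithfully
   represented inside 'M[R]_4 (which carries MathComp-Analysis' normed
   structure, needed for derivatives of curves). *)
Definition cmx (M : 'M[C]_2) : 'M[R]_4 :=
  \matrix_(i < 4, j < 4)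
    let z := M (inord (i./2)) (inord (j./2)) in
    if odd i == odd j then complex.Re z
    else if odd i then complex.Im z else - complex.Im z.

(* The identity of SU(2). *)
Definition Id4 : 'M[R]_4 := cmx 1%:M.

(* SU(2) = { [[alpha, beta], [-conj beta, conj alpha]] : |alpha|^2+|beta|^2=1 } *)
Definition SU2 : set 'M[R]_4 :=
  [set g | exists alpha beta : C,
     `|alpha| ^+ 2 + `|beta| ^+ 2 = 1 /\
     g = cmx (mx2 alpha beta (- (beta^*)%C) (alpha^*)%C)].

(* p1, p2, k *)
Definition p1 : 'M[R]_4 := cmx (mx2 0 (1 / 2) (- (1 / 2)) 0).
Definition p2 : 'M[R]_4 := cmx (mx2 0 ('i%C / 2) ('i%C / 2) 0).
Definition kk : 'M[R]_4 := cmx (mx2 ('i%C / 2) 0 0 (- ('i%C / 2))).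

(* the subspace p = span {p1, p2} *)
Definition in_p (X : 'M[R]_4) : Prop :=
  exists u1 u2 : R, X = u1 *: p1 + u2 *: p2.

(* The inner product on p making p1, p2 orthonormal:
   for X, Y in p one has <X,Y> = - tr_R (X Y)  (tr_R of the realification is
   twice the real part of the complex trace, and <X,Y> = -2 Re tr_C (XY));
   see the lemmas pip_* below for orthonormality of p1, p2. *)
Definition pip (X Y : 'M[R]_4) : R := - \tr (X *m Y).

(* matrix exponential *)
Definition expm (X : 'M[R]_4) : 'M[R]_4 :=
  lim ([series (n`!%:R^-1 : R) *: X ^+ n]_n @ \oo).

(* body velocity g^{-1} gamma'(t) of a curve *)
Definition bodyvel (gam : R -> 'M[R]_4) (t : R) : 'M[R]_4 :=
  invmx (gam t) *m 'D_1 gam t.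

(* horizontal curves gam : [0,T] -> SU(2) (values outside [0,T] irrelevant):
   Lipschitz, with velocity a.e. in Delta(gam t) = gam t p. *)
Definition horizontal (T : R) (gam : R -> 'M[R]_4) : Prop :=
  0 <= T /\
  (forall t, 0 <= t <= T -> SU2 (gam t)) /\
  (exists L : R, forall s t, 0 <= s <= T -> 0 <= t <= T ->
      `|gam s - gam t| <= L * `|s - t|) /\
  {ae (@lebesgue_measure R), forall t, 0 <= t <= T ->
      derivable gam t 1 /\ in_p (bodyvel gam t)}.

(* length = int_0^T sqrt(g(gam', gam')), g_g(v,w) = <g^{-1}v, g^{-1}w> *)
Definition itv0 (T : R) : set R := `[0, T]%classic.

Definition sr_length (T : R) (gam : R -> 'M[R]_4) : \bar R :=
  (\int[(@lebesgue_measure R)]_(t in itv0 T)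
     (Num.sqrt (pip (bodyvel gam t) (bodyvel gam t)))%:E)%E.

(* sub-Riemannian (Carnot-Caratheodory) distance on SU(2) *)
Definition sr_dist (g h : 'M[R]_4) : \bar R :=
  ereal_inf [set l | exists (T : R) (gam : R -> 'M[R]_4),
     [/\ horizontal T gam, gam 0 = g, gam T = h & l = sr_length T gam]].

(* decomposition g = e^{-b p2} e^{a p1} e^{c p2}, a in [0,pi], b in [0,2pi),
   c real (c is only relevant modulo 4pi) *)
Definition decomp (g : 'M[R]_4) (a b c : R) : Prop :=
  [/\ 0 <= a <= pi, 0 <= b < 2 * pi &
      g = expm ((- b) *: p2) *m expm (a *: p1) *m expm (c *: p2)].

(* the relation g1 ~ g2 defining L(4,1) *)
Definition lequiv (g1 g2 : 'M[R]_4) : Prop :=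
  exists a b c1 c2 : R, [/\ decomp g1 a b c1, decomp g2 a b c2 &
     exists n : int, c1 - c2 = n%:~R * pi].

(* Curves in L(4,1) are modelled as projections Pi o gam of horizontal curves
   gam of SU(2) (every horizontal curve of L(4,1) arises so, by path lifting
   along the covering Pi, with the same length).
   Distance on L(4,1) from [g] to [h]. *)
Definition lhat_dist (g h : 'M[R]_4) : \bar R :=
  ereal_inf [set l | exists (T : R) (gam : R -> 'M[R]_4),
     [/\ horizontal T gam, lequiv (gam 0) g, lequiv (gam T) h
       & l = sr_length T gam]].

(* (projection of) a geodesic of L(4,1) from [Id] on [0,t], parametrized by
   arclength and length-minimizing on [0,t] *)
Definition min_geod_from_Id (t : R) (gam : R -> 'M[R]_4) : Prop :=
  [/\ horizontal t gam, lequiv (gam 0) Id4,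
      {ae (@lebesgue_measure R), forall s, 0 <= s <= t ->
          pip (bodyvel gam s) (bodyvel gam s) = 1}
    & sr_length t gam = lhat_dist Id4 (gam t)].

(* the cut locus K_[Id] of L(4,1), as a predicate on representatives *)
Definition cut_locus (g : 'M[R]_4) : Prop :=
  exists t : R, 0 < t /\
  exists gam1 gam2 : R -> 'M[R]_4,
    [/\ min_geod_from_Id t gam1, min_geod_from_Id t gam2,
        lequiv (gam1 t) g, lequiv (gam2 t) g &
        exists s, 0 <= s <= t /\ ~ lequiv (gam1 s) (gam2 s)].

(* K^loc = { [e^{tk}] : t in R } \ { [Id] } *)
Definition K_loc (g : 'M[R]_4) : Prop :=
  (exists t : R, lequiv g (expm (t *: kk))) /\ ~ lequiv g Id4.

(* K^sym, with g itself as the fixed representative g* of [g] *)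
Definition K_sym (g : 'M[R]_4) : Prop :=
  exists x1 x2 : 'M[R]_4,
    [/\ lequiv x1 Id4, lequiv x2 Id4, x1 <> x2,
        sr_dist g x1 = sr_dist g x2 &
        forall xs, lequiv xs Id4 -> (sr_dist g x1 <= sr_dist g xs)%E].

End SubRiemannianL41.

(* Main.v *)
Require Import Defs.
From mathcomp Require Import all_boot all_order all_algebra.
From mathcomp Require Import all_classical all_reals all_analysis.
From mathcomp Require Import complex measurable_realfun ring lra.

(** Write g in SU(2) as a pair (alpha, beta). The class [Id] is the cyclic group
    generated by 2 p2, which acts by right translations that are isometries, so
    lifting to SU(2) reduces the theorem to the minimizers of SU(2) starting at Id.

    Let g be horizontal with speed L' and length M = L(T). For every c the curve
    h = g e^{c L k} has speed L' sqrt (1 + c^2) for the bi-invariant metric of the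
    3-sphere, hence M sqrt (1 + c^2) is at least the spherical distance from Id to
    g(T) e^{c M k}. Choosing c for the sub-Riemannian geodesic ending at g(T) (one
    exists by the intermediate value theorem), this gives its minimality; and if
    |alpha| < 1 at the end point, equality forces h to be a great circle, hence
    uniqueness. So two distinct minimizers from Id can only share an end point where
    beta = 0, that is on the subgroup e^{tk}.

    Conversely, rotating beta by pi maps a minimizer ending in the class of e^{tk}
    to another one, and two nearest points of [Id] give two minimizers; these
    remain distinct in L(4,1) because [Id] is discrete. *)

Set Implicit Arguments.
Unset Strict Implicit.
Unset Printing Implicit Defensive.

Import Order.TTheory GRing.Theory Num.Theory.
Import numFieldNormedType.Exports.
Local Open Scope classical_set_scope.
Local Open Scope ring_scope.

(** * Quaternion coordinates on SU(2) *)

(** Conjugation by e^{tk} preserves p, and k is orthogonal to p. Hence the twist e^{cLk} keeps the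
    norm of the horizontal velocity and adds a component of norm c L' orthogonal to it. The twist is
    normalised by the competitor's own length M: its total amount is then prescribed by the end
    point, and the spherical inequality becomes one for M alone. Two obstacles shape the analytic
    half. Horizontal curves are only Lipschitz, so the estimate must be drawn from derivatives known
    almost everywhere. And acos is not Lipschitz at 1, which is the very value of the inner product
    at which the estimate starts. The case |alpha| = 1 escapes uniqueness because the twisted end
    point is then antipodal to the start, and antipodal points are joined by many great circles.
    Left translations are always isometries. Right translation by 2 p2 is one because conjugation by
    2 p2 fixes p2 and negates p1 and k, hence preserves p. *)

Section Quaternions.
Variable R : realType.
Implicit Types a b c d x : R.

(* The realification of [[a + ib, c + id], [-c + id, a - ib]]. *)
Definition qm a b c d : 'M[R]_4 :=
  \matrix_(i < 4, j < 4)
    nth 0 (nth [::] [:: [:: a; - b; c; - d]; [:: b; a; d; c];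
                        [:: - c; - d; a; b]; [:: d; - c; - b; a]] i) j.

Lemma cmx_qm a b c d :
  cmx (mx2 (a +i* b)%C (c +i* d)%C (- c +i* d)%C (a -i* b)%C) = qm a b c d.
Proof.
apply/matrixP => i j; rewrite !mxE.
case: i => -[|[|[|[|//]]]] ?; case: j => -[|[|[|[|//]]]] ?;
  by rewrite /= ?inordK //= ?opprK.
Qed.

Lemma qm_inj a b c d a' b' c' d' : qm a b c d = qm a' b' c' d' ->
  [/\ a = a', b = b', c = c' & d = d'].
Proof.
move=> /matrixP e; split.
- by have := e ord0 ord0; rewrite !mxE.
- by have := e (inord 1) ord0; rewrite !mxE ?inordK.
- by have := e ord0 (inord 2); rewrite !mxE ?inordK.
- by have := e (inord 3) ord0; rewrite !mxE ?inordK.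
Qed.

Lemma qmM a b c d a' b' c' d' :
  qm a b c d *m qm a' b' c' d' =
  qm (a * a' - b * b' - c * c' - d * d') (a * b' + b * a' - d * c' + c * d')
     (a * c' - b * d' + c * a' + d * b') (a * d' + b * c' + d * a' - c * b').
Proof.
apply/matrixP => i j; rewrite !mxE !big_ord_recl big_ord0 !mxE.
case: i => -[|[|[|[|//]]]] ?; case: j => -[|[|[|[|//]]]] ? /=; ring.
Qed.

Lemma qmD a b c d a' b' c' d' :
  qm a b c d + qm a' b' c' d' = qm (a + a') (b + b') (c + c') (d + d').
Proof.
apply/matrixP => i j; rewrite !mxE.
case: i => -[|[|[|[|//]]]] ?; case: j => -[|[|[|[|//]]]] ? /=; ring.
Qed.

Lemma qmZ x a b c d : x *: qm a b c d = qm (x * a) (x * b) (x * c) (x * d).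
Proof.
apply/matrixP => i j; rewrite !mxE.
case: i => -[|[|[|[|//]]]] ?; case: j => -[|[|[|[|//]]]] ? /=; ring.
Qed.

Lemma qm1 : qm 1 0 0 0 = 1%:M.
Proof.
apply/matrixP => i j; rewrite !mxE.
case: i => -[|[|[|[|//]]]] ?; case: j => -[|[|[|[|//]]]] ? /=;
  by rewrite ?oppr0.
Qed.

Lemma trqm a b c d : \tr (qm a b c d) = 4 * a.
Proof. rewrite /mxtrace !big_ord_recl big_ord0 !mxE /=; ring. Qed.

Lemma Id4E : Id4 R = qm 1 0 0 0.
Proof.
rewrite -cmx_qm; congr cmx; apply/matrixP => i j; rewrite !mxE.
by case: i => -[|[|//]] ?; case: j => -[|[|//]] ? /=; rewrite ?oppr0.
Qed.

Lemma half_complex : (1 / 2 : R[i]) = ((1 / 2) +i* 0)%C.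
Proof.
rewrite !mul1r; apply: (@mulfI _ (2 : R[i])); first by rewrite pnatr_eq0.
rewrite divff ?pnatr_eq0 // mulr_natl mulr2n.
rewrite [in LHS]/1 /=; apply/eqP; rewrite eq_complex /=.
by apply/andP; split; apply/eqP; [field|rewrite addr0].
Qed.

Lemma ihalf_complex : ('i%C / 2 : R[i]) = (0 +i* (1 / 2))%C.
Proof.
have -> : ('i%C / 2 : R[i]) = 'i%C * (1 / 2) by rewrite mul1r.
rewrite half_complex; apply/eqP; rewrite eq_complex /=.
by apply/andP; split; apply/eqP; ring.
Qed.

Lemma p1E : p1 R = qm 0 0 (1 / 2) 0.
Proof.
rewrite -cmx_qm /p1 half_complex; congr (cmx (mx2 _ _ _ _)).
- by apply/eqP; rewrite eq_complex /= oppr0 !eqxx.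
- by apply/eqP; rewrite eq_complex /= oppr0 !eqxx.
Qed.

Lemma p2E : p2 R = qm 0 0 0 (1 / 2).
Proof.
rewrite -cmx_qm /p2 ihalf_complex; congr (cmx (mx2 _ _ _ _)).
- by apply/eqP; rewrite eq_complex /= oppr0 !eqxx.
- by apply/eqP; rewrite eq_complex /= oppr0 !eqxx.
Qed.

Lemma kkE : kk R = qm 0 (1 / 2) 0 0.
Proof.
rewrite -cmx_qm /kk ihalf_complex; congr (cmx (mx2 _ _ _ _)).
- by apply/eqP; rewrite eq_complex /= oppr0 !eqxx.
- by apply/eqP; rewrite eq_complex /= oppr0 !eqxx.
Qed.

Definition nrm2 a b c d := a ^+ 2 + b ^+ 2 + c ^+ 2 + d ^+ 2.

Lemma SU2P (g : 'M[R]_4) :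
  SU2 g <-> exists a b c d, nrm2 a b c d = 1 /\ g = qm a b c d.
Proof.
have nE a b c d : (`|(a +i* b)%C| ^+ 2 + `|(c +i* d)%C| ^+ 2 = 1 :> R[i]) <->
    nrm2 a b c d = 1.
  rewrite !normc_def /= -!rmorphXn /= -rmorphD /= !sqr_sqrtr ?addr_ge0 ?sqr_ge0 //.
  rewrite /nrm2 !addrA; split=> [|->//].
  by move=> /(congr1 (@complex.Re R)).
split=> [[[a b] [[c d] [n ->]]]|[a [b [c [d [n ->]]]]]].
  exists a, b, c, d; split; first exact/nE.
  by rewrite -cmx_qm; congr (cmx (mx2 _ _ _ _)); rewrite /=; apply/eqP; rewrite
    eq_complex /= ?opprK !eqxx.
exists (a +i* b)%C, (c +i* d)%C; split; first exact/nE.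
rewrite -cmx_qm; congr (cmx (mx2 _ _ _ _)); rewrite /=; apply/eqP; by rewrite
  eq_complex /= ?opprK !eqxx.
Qed.

Lemma SU2_qm a b c d : nrm2 a b c d = 1 -> SU2 (qm a b c d).
Proof. by move=> n; apply/SU2P; exists a, b, c, d. Qed.

Lemma qmJ a b c d : nrm2 a b c d = 1 ->
  qm a (- b) (- c) (- d) *m qm a b c d = 1%:M.
Proof. by move=> n; rewrite qmM -qm1; congr qm; rewrite ?/nrm2 -?n /nrm2; ring. Qed.

Lemma qm_inv a b c d : nrm2 a b c d = 1 ->
  invmx (qm a b c d) = qm a (- b) (- c) (- d).
Proof.
move=> n; have e := qmJ n.
have u : qm a b c d \in unitmx by case/mulmx1_unit: e.
by rewrite -[RHS]mulmx1 -(mulmxV u) mulmxA e mul1mx.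
Qed.

Lemma qmN a b c d : - qm a b c d = qm (- a) (- b) (- c) (- d).
Proof. by rewrite -scaleN1r qmZ !mulN1r. Qed.

(** A unit imaginary quaternion squares to -1, so its exponential series splits into the cosine
    series and U times the sine series. *)
Lemma qm_expm (u v w t : R) : nrm2 0 u v w = 1 ->
  expm (t *: qm 0 u v w) = qm (cos t) (sin t * u) (sin t * v) (sin t * w).
Proof.
move=> n; set U := qm 0 u v w.
have UU : U * U = -1.
  rewrite /U [LHS]qmM -[1]/(1%:M) -qm1 qmN; congr qm; try ring.
  by rewrite -n /nrm2; ring.
(* This has the shape of [cos_coeff] and [sin_coeff]; the truncated [k.-1] at [k = 0] is harmless,
   as [odd 0] is false. *)
have Un k : U ^+ k = ((~~ odd k)%:R * (-1) ^+ k./2) *: 1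
      + ((odd k)%:R * (-1) ^+ k.-1./2) *: U.
  elim: k => [|k IH]; first by rewrite expr0 /= !mul1r !mul0r scale1r scale0r addr0.
  rewrite exprSr IH mulrDl -!scalerAl mul1r UU /= negbK.
  have [ok|ok] := boolP (odd k) => /=.
    rewrite !mul0r !scale0r addr0 add0r !mul1r scalerN -scaleNr; congr (_ *: _).
    by rewrite -[k in uphalf k]odd_double_half -[k in k.-1]odd_double_half ok add1n /=
      !doubleK exprS mulN1r.
  by rewrite !mul0r !scale0r addr0 add0r !mul1r.
have -> : qm (cos t) (sin t * u) (sin t * v) (sin t * w) = cos t *: 1 + sin t *: U.
  rewrite -[1]/(1%:M) -qm1 /U !qmZ qmD; congr qm; ring.
rewrite /expm; apply/cvg_lim; first exact: norm_hausdorff.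
have -> : [series n`!%:R^-1 *: (t *: U) ^+ n]_n =
  (fun n => series (cos_coeff t) n *: (1 : 'M[R]_4) + series (sin_coeff t) n *: U).
  apply/funext => k; rewrite /series /= !scaler_suml -big_split /=.
  apply: eq_bigr => i _; rewrite exprZn Un !scalerDr !scalerA /cos_coeff /sin_coeff /=
    -?exprnP.
  by congr (_ *: _ + _ *: _); ring.
rewrite cos.unlock sin.unlock.
apply: cvgD; apply: cvgZr_tmp.
  exact: is_cvg_series_cos_coeff.
exact: is_cvg_series_sin_coeff.
Qed.

(** [p1] is half of a unit imaginary quaternion, as are [p2] and [kk]; hence the half angles from
    here on. *)
Lemma expm_p1 t : expm (t *: p1 R) = qm (cos (t / 2)) 0 (sin (t / 2)) 0.
Proof.
have := @qm_expm 0 1 0 (t / 2); rewrite !mulr0 mulr1 => <-; last by rewrite /nrm2; ring.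
by rewrite p1E !qmZ; congr expm; congr qm; ring.
Qed.

Lemma expm_p2 t : expm (t *: p2 R) = qm (cos (t / 2)) 0 0 (sin (t / 2)).
Proof.
have := @qm_expm 0 0 1 (t / 2); rewrite !mulr0 mulr1 => <-; last by rewrite /nrm2; ring.
by rewrite p2E !qmZ; congr expm; congr qm; ring.
Qed.

Lemma expm_kk t : expm (t *: kk R) = qm (cos (t / 2)) (sin (t / 2)) 0 0.
Proof.
have := @qm_expm 1 0 0 (t / 2); rewrite !mulr0 mulr1 => <-; last by rewrite /nrm2; ring.
by rewrite kkE !qmZ; congr expm; congr qm; ring.
Qed.

Lemma nrm2M a b c d a' b' c' d' :
  nrm2 (a * a' - b * b' - c * c' - d * d') (a * b' + b * a' - d * c' + c * d')
     (a * c' - b * d' + c * a' + d * b') (a * d' + b * c' + d * a' - c * b')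
  = nrm2 a b c d * nrm2 a' b' c' d'.
Proof. by rewrite /nrm2; ring. Qed.

Lemma SU2M (g h : 'M[R]_4) : SU2 g -> SU2 h -> SU2 (g *m h).
Proof.
move=> /SU2P[a [b [c [d [n ->]]]]] /SU2P[a' [b' [c' [d' [n' ->]]]]].
by rewrite qmM; apply: SU2_qm; rewrite nrm2M n n' mulr1.
Qed.

Lemma SU2_unit (g : 'M[R]_4) : SU2 g -> g \in unitmx.
Proof.
by move=> /SU2P[a [b [c [d [n ->]]]]]; case/mulmx1_unit: (qmJ n).
Qed.

Lemma SU2V (g : 'M[R]_4) : SU2 g -> SU2 (invmx g).
Proof.
move=> /SU2P[a [b [c [d [n ->]]]]]; rewrite (qm_inv n).
by apply: SU2_qm; rewrite /nrm2 !sqrrN.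
Qed.

Lemma SU21 : SU2 (1%:M : 'M[R]_4).
Proof.
by apply/SU2P; exists 1, 0, 0, 0; split; [rewrite /nrm2; ring|rewrite qm1].
Qed.

(** * Polar angles, the decomposition, and the relation defining L(4,1) *)

Lemma circle_angle (x y : R) : x ^+ 2 + y ^+ 2 = 1 ->
  exists2 t : R, -pi <= t <= pi & x = cos t /\ y = sin t.
Proof.
move=> xy.
have x1 : -1 <= x <= 1.
  rewrite -ler_norml -(expr_le1 (n := 2)) // real_normK ?num_real //.
  by rewrite -xy lerDl sqr_ge0.
have e : `|y| = sin (acos x).
  by rewrite sin_acos // -xy addrAC subrr add0r sqrtr_sqr.
have [y0|y0] := leP 0 y.
  exists (acos x); last by rewrite acosK ?in_itv // -e ger0_norm.
  by rewrite acos_lepi // andbT (le_trans _ (acos_ge0 _)) // oppr_le0 pi_ge0.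
exists (- acos x); last first.
  by rewrite cosN acosK ?in_itv // sinN -e ltr0_norm // opprK.
by rewrite lerN2 acos_lepi //= (@le_trans _ _ 0) ?pi_ge0 // oppr_le0 acos_ge0.
Qed.

Lemma polar (x y : R) : exists2 t : R, -pi <= t <= pi &
  x = Num.sqrt (x ^+ 2 + y ^+ 2) * cos t /\ y = Num.sqrt (x ^+ 2 + y ^+ 2) * sin t.
Proof.
set r := Num.sqrt _.
have rE : r ^+ 2 = x ^+ 2 + y ^+ 2 by rewrite sqr_sqrtr // addr_ge0 ?sqr_ge0.
have [r0|r0] := eqVneq r 0.
  exists 0; first by rewrite oppr_le0 pi_ge0.
  move/eqP: rE; rewrite r0 expr0n /= eq_sym paddr_eq0 ?sqr_ge0 // !sqrf_eq0.
  by rewrite !mul0r => /andP[/eqP-> /eqP->].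
have [|t tpi [xt yt]] := @circle_angle (x / r) (y / r).
  by rewrite !expr_div_n -mulrDl -rE divff // sqrf_eq0.
by exists t => //; rewrite -xt -yt ![r * _]mulrC !divfK.
Qed.

(** The first and fourth coordinates form a plane vector in polar form, and so do the third and
    second. Their radii are cos (t1 / 2) and sin (t1 / 2), so the angles (t3 - t2) / 2 and (t3 + t2)
    / 2 can be solved for separately. *)
Lemma decompE (t1 t2 t3 : R) :
  expm ((- t2) *: p2 R) *m expm (t1 *: p1 R) *m expm (t3 *: p2 R) =
  qm (cos (t1 / 2) * cos ((t3 - t2) / 2)) (sin (t1 / 2) * sin ((t3 + t2) / 2))
     (sin (t1 / 2) * cos ((t3 + t2) / 2)) (cos (t1 / 2) * sin ((t3 - t2) / 2)).
Proof.
rewrite !expm_p2 expm_p1 !qmM !mulrBl !mulrDl cosB sinB cosD sinD mulNr cosN sinN.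
by congr qm; ring.
Qed.

Lemma decomp_ex (g : 'M[R]_4) : SU2 g -> exists t1 t2 t3, decomp g t1 t2 t3.
Proof.
move=> /SU2P[a [b [c [d [n ->]]]]].
have [u u_pi [ae de]] := polar a d; have [v v_pi [ce be]] := polar c b.
set r := Num.sqrt (a ^+ 2 + d ^+ 2) in ae de.
set s := Num.sqrt (c ^+ 2 + b ^+ 2) in ce be.
have r2 : r ^+ 2 = a ^+ 2 + d ^+ 2 by rewrite sqr_sqrtr // addr_ge0 ?sqr_ge0.
have s2 : s ^+ 2 = c ^+ 2 + b ^+ 2 by rewrite sqr_sqrtr // addr_ge0 ?sqr_ge0.
have rs : r ^+ 2 + s ^+ 2 = 1 by rewrite r2 s2 -n /nrm2; ring.
have [t t_pi [rt st]] := circle_angle rs.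
have rt' : 0 <= cos t by rewrite -rt sqrtr_ge0.
have st' : 0 <= sin t by rewrite -st sqrtr_ge0.
have [t' t'_pi [ct stt]] : exists2 t', 0 <= t' <= pi & cos (t' / 2) = r /\ sin (t' / 2) = s.
  have r1 : -1 <= r <= 1 by rewrite rt cos_geN1 cos_le1.
  have sr : sin (acos r) = s.
    rewrite sin_acos // -rs addrAC subrr add0r sqrtr_sqr ger0_norm //.
    by rewrite st.
  exists (2 * acos r); last first.
    by rewrite mulrAC divff ?pnatr_eq0 // mul1r acosK ?in_itv.
  have a0 := acos_ge0 r1.
  rewrite mulr_ge0 //=.
  suff : acos r <= pi / 2 by lra.
  rewrite -acos0 leNgt; apply/negP => h.
  have : cos (acos r) < cos (acos 0) :> R.
    by rewrite ltr_cos // ?in_itv /= ?acos_ge0 ?acos_lepi // ?ler0N1 ?ler01 ?lerN10.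
  by rewrite !acosK ?in_itv /= ?lerN10 ?ler01 // rt ltNge rt'.
have key (B C : R) : 0 <= B < 2 * pi -> cos ((C - B) / 2) = cos u -> sin ((C - B) / 2)
  = sin u ->
   cos ((C + B) / 2) = cos v -> sin ((C + B) / 2) = sin v -> decomp (qm a b c d) t' B C.
  move=> Bp e1 e2 e3 e4; split => //.
  by rewrite decompE e1 e2 e3 e4 ct stt -ae -de -ce -be.
have c2 x : cos (x + 2 * pi) = cos x by rewrite mulr_natl cosD2pi.
have s2' x : sin (x + 2 * pi) = sin x by rewrite mulr_natl mulr2n addrA !sinDpi opprK.
have c3 : cos (v - 2 * pi) = cos v by rewrite -c2 subrK.
have s3 : sin (v - 2 * pi) = sin v by rewrite -s2' subrK.
(* B = v - u and C = v + u solve the angle equations. Shifting both by 2 pi fixes (C - B) / 2, moves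
   (C + B) / 2 by a full turn, and brings B into [0, 2 pi). *)
have [uv|uv] := leP u v; last first.
  exists t', (v - u + 2 * pi), (v + u + 2 * pi); apply: key; first lra.
  - by congr cos; field.
  - by congr sin; field.
  - by rewrite -(c2 v); congr cos; field.
  - by rewrite -(s2' v); congr sin; field.
have [uv'|uv'] := ltP (v - u) (2 * pi).
  exists t', (v - u), (v + u); apply: key; first by rewrite subr_ge0 uv.
  - by congr cos; field.
  - by congr sin; field.
  - by congr cos; field.
  - by congr sin; field.
exists t', (v - u - 2 * pi), (v + u - 2 * pi); apply: key; first by have := pi_gt0 R; lra.
- by congr cos; field.
- by congr sin; field.
- by rewrite -c3; congr cos; field.
- by rewrite -s3; congr sin; field.
Qed.

(* [Id] is the cyclic group of order 4 generated by 2 p2 = e^{pi p2}. *)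
Definition id_class (x : 'M[R]_4) : Prop :=
  [\/ x = qm 1 0 0 0, x = qm (-1) 0 0 0, x = qm 0 0 0 1 | x = qm 0 0 0 (-1)].

Lemma id_class_SU2 (x : 'M[R]_4) : id_class x -> SU2 x.
Proof.
by case=> ->; apply: SU2_qm; rewrite /nrm2; ring.
Qed.

Lemma id_classM (x y : 'M[R]_4) : id_class x -> id_class y -> id_class (x *m y).
Proof.
case=> ->; case=> ->; rewrite qmM;
  [constructor 1|constructor 2|constructor 3|constructor 4
  |constructor 2|constructor 1|constructor 4|constructor 3
  |constructor 3|constructor 4|constructor 2|constructor 1
  |constructor 4|constructor 3|constructor 1|constructor 2];
  congr qm; ring.
Qed.

Lemma id_classV (x : 'M[R]_4) : id_class x -> id_class (invmx x).
Proof.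
case=> ->; (rewrite qm_inv; last by rewrite /nrm2; ring);
  [constructor 1|constructor 2|constructor 4|constructor 3]; congr qm; ring.
Qed.

Lemma id_class_id : id_class 1%:M.
Proof. by constructor 1; rewrite qm1. Qed.

Lemma sin_int_pi (n : int) : sin (n%:~R * pi) = 0 :> R.
Proof.
elim/int_ind: n => [|n IH|n IH]; first by rewrite mul0r sin0.
- by rewrite -addn1 PoszD intrD mulrDl mul1r sinDpi IH oppr0.
- have := sinDpi ((- n.+1%:Z)%:~R * pi : R).
  rewrite -[X in _ + X]mul1r -mulrDl -addn1 PoszD opprD intrD subrK IH => /eqP.
  by rewrite eq_sym oppr_eq0 => /eqP.
Qed.

(** For the angle x = n pi / 2, sin (2 x) = 0: one of sin x, cos x vanishes and the other is 1 or
    -1. This replaces a discussion of n modulo 4. *)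
Lemma id_class_expm (n : int) : id_class (expm ((n%:~R * pi) *: p2 R)).
Proof.
rewrite expm_p2; set x := _ / 2.
have : sin (x + x) = 0 by rewrite -splitr sin_int_pi.
rewrite sinD mulrC -mulr2n => /eqP; rewrite mulrn_eq0 /= mulf_eq0.
have cs := cos2Dsin2 x.
case/orP => /eqP e; move: cs; rewrite e expr0n /= ?add0r ?addr0 => /eqP;
  rewrite sqrf_eq1 => /orP[] /eqP ->;
  [constructor 3|constructor 4|constructor 1|constructor 2]; reflexivity.
Qed.

(** With a and b shared, changing c by n pi is right multiplication by e^{n pi p2}; conversely, any
    decomposition of g also serves for [g *m q]. Classes are thus cosets g [Id], and the angles
    disappear from all later arguments. *)
Lemma lequivP (g h : 'M[R]_4) :
  lequiv g h <-> SU2 g /\ exists2 q, id_class q & h = g *m q.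
Proof.
have expS2 t : SU2 (expm (t *: p2 R)).
  rewrite expm_p2; apply: SU2_qm.
  by rewrite /nrm2 expr0n /= !addr0 cos2Dsin2.
have expS1 t : SU2 (expm (t *: p1 R)).
  rewrite expm_p1; apply: SU2_qm.
  by rewrite /nrm2 expr0n /= !addr0 cos2Dsin2.
have expD s t : expm (s *: p2 R) *m expm (t *: p2 R) = expm ((s + t) *: p2 R).
  by rewrite !expm_p2 qmM mulrDl cosD sinD; congr qm; ring.
split.
  move=> [a [b [c1 [c2 [[ha hb hg] [_ _ hh] [n nE]]]]]]; split.
    by rewrite hg; apply: SU2M => //; apply: SU2M.
  exists (expm (((- n)%:~R * pi) *: p2 R)); first exact: id_class_expm.
  have c2E : c2 = c1 + (- n)%:~R * pi by rewrite intrN; lra.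
  by rewrite hh hg c2E -(expD c1); exact: mulmxA.
move=> [gS [q qc ->]]; have [a [b [c [ha hb hg]]]] := decomp_ex gS.
have key (n : int) : q = expm ((n%:~R * pi) *: p2 R) -> lequiv g (g *m q).
  move=> qE; exists a, b, c, (c + n%:~R * pi); split.
  - by split.
  - by split => //; rewrite hg qE -(expD c); apply/esym; exact: mulmxA.
  - by exists (- n); rewrite intrN; ring.
(* In the order of [id_class], the elements are e^{n pi p2} for n = 0, 2, 1, -1. *)
case: qc => qE; [apply: (key 0)|apply: (key 2)|apply: (key 1)|apply: (key (-1))];
  rewrite qE expm_p2.
- by rewrite !mul0r cos0 sin0.
- by rewrite mulrAC divff ?mul1r ?cospi ?sinpi // intr_eq0.
- by rewrite mul1r cos_pihalf sin_pihalf.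
- by rewrite mulN1r mulNr cosN sinN cos_pihalf sin_pihalf.
Qed.

End Quaternions.

(** * Lipschitz functions and almost everywhere derivatives *)

Section Lip.
Variable R : realType.
Notation mu := (@lebesgue_measure R).
Implicit Types (f g : R -> R) (a b c d t s T : R).

(** Continuous induction: the supremum m of the points up to which P holds satisfies P by the limit
    hypothesis, and m < b would contradict the extension hypothesis. *)
Lemma sup_induction (P : R -> Prop) a b : a <= b ->
  P a ->
  (forall t, a <= t < b -> (forall s, a <= s <= t -> P s) ->
     exists2 e, 0 < e & forall s, t < s < t + e -> P s) ->
  (forall t, a < t <= b -> (forall s, a <= s < t -> P s) -> P t) ->
  P b.
Proof.
move=> ab Pa Pnext Plim.
pose S := [set t | a <= t <= b /\ forall s, a <= s <= t -> P s].
have Sa : S a.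
  by split; [rewrite lexx|move=> s /le_anti <-].
have Sub : ubound S b by move=> t [/andP[]].
have hs : has_sup S by split; [exists a|exists b].
set m := sup S.
have am : a <= m by exact: ub_le_sup hs.2 _ Sa.
have mb : m <= b by apply: ge_sup => //; exists a.
have Plt s : a <= s < m -> P s.
  move=> /andP[as_ sm].
  have [t [_ Ht] st] := sup_adherent (eps := m - s) ltac:(by rewrite subr_gt0) hs.
  by apply: Ht; rewrite as_ /=; rewrite subKr in st; exact: ltW.
have Pm : P m.
  have [->//|/eqP ne] := pselect (m = a).
  by apply: Plim => //; rewrite lt_neqAle eq_sym ne am.
have Ple s : a <= s <= m -> P s.
  move=> /andP[as_]; rewrite le_eqVlt => /orP[/eqP->//|sm].
  by apply: Plt; rewrite as_.
have [mb'|] := ltP m b; last by move=> bm; have -> : b = m by apply/le_anti; rewrite bm mb.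
have [e e0 He] := Pnext m ltac:(by rewrite am) Ple.
(* Half of e, because P is only known strictly below [m + e]. *)
pose t := Num.min b (m + e / 2).
have : S t.
  split; first by rewrite /t ge_min lexx le_min ab /= (le_trans am) // lerDl divr_ge0
    // ltW.
  move=> s /andP[as_ st]; have [sm|ms] := leP s m; first by apply: Ple; rewrite as_.
  apply: He; rewrite ms /=; apply: le_lt_trans st _.
  by rewrite /t gt_min ltrD2l [e / 2 < e]ltr_pdivrMr // ltr_pMr // ltr1n orbT.
move/(ub_le_sup hs.2); rewrite -/m leNgt /t lt_min mb' ltrDl /=.
by rewrite divr_gt0.
Qed.

(* The exceptional null set is covered by an open set U of small measure, and
   f t <= f a + eta (t - a) + K mu (U `&` [a, t]) holds by continuous induction. *)
Lemma lipschitz_ae_noninc f K a b : a <= b ->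
  (forall s t, a <= s -> s <= t -> t <= b -> f t - f s <= K * (t - s)) ->
  {ae mu, forall t, a < t < b -> derivable f t 1 /\ 'D_1 f t <= 0} ->
  f b <= f a.
Proof.
move=> ab lip [N [mN N0 HN]].
wlog K0 : K lip / 0 < K.
  move=> h; apply: (h (`|K| + 1)); last by rewrite ltr_wpDl.
  move=> s t as_ st tb; apply: (le_trans (lip _ _ as_ st tb)).
  by rewrite ler_wpM2r ?subr_ge0 // (le_trans (ler_norm _)) // lerDl.
apply/ler_addgt0Pr => e e0.
(* The summand 1 keeps the denominator positive when a = b. The errors [eta * (b - a)] and [K * m b]
   will each be at most e / 2. *)
pose eta := e / 2 / (b - a + 1).
have ba : 0 < b - a + 1 by rewrite ltr_wpDl // subr_ge0.
have eta0 : 0 < eta by rewrite !divr_gt0.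
(* The derivative is controlled only for t > a, so the left end point joins the null set. *)
pose N' := N `|` [set a].
have mN' : measurable N' by apply: measurableU.
have muN' : mu N' = 0%E.
  apply/eqP; rewrite eq_le measure_ge0 andbT.
  apply: (le_trans (measureU2 _ _ _)) => //.
  by rewrite [X in (X + _)%E]N0 add0e; have := lebesgue_measure_set1 a => <-.
have [U [oU N'U muU]] : exists U : set R, [/\ open U, N' `<=` U & (mu (U `\` N') < (e /
  2 / K)%:E)%E].
  by apply: lebesgue_regularity_outer => //; [apply: (@le_lt_trans _ _ 0%E); [by
    rewrite le_eqVlt; apply/orP; left; apply/eqP; exact: muN'|exact: ltry]|rewrite
      !divr_gt0].
have mU : measurable U by exact: measurable_realfun.open_measurable.
have muU' : (mu U <= (e / 2 / K)%:E)%E.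
  rewrite -(setDUK N'U); apply: (le_trans (measureU2 _ _ _)) => //; first exact:
    measurableD.
  by rewrite [X in (X + _)%E]muN' add0e ltW.
pose m t := fine (mu (U `&` `[a, t])).
have mfin t : mu (U `&` `[a, t]) \is a fin_num.
  rewrite ge0_fin_numE //; apply: le_lt_trans (ltry (e / 2 / K)).
  apply: le_trans muU'; apply: le_measure; rewrite ?inE //; first exact: measurableI.
have m0 t : 0 <= m t by apply: fine_ge0.
have mle t : m t <= e / 2 / K.
  rewrite -lee_fin fineK //; apply: le_trans muU'; apply: le_measure; rewrite ?inE //;
    first exact: measurableI.
have mmono s t : s <= t -> m s <= m t.
  move=> st; apply: fine_le => //; apply: le_measure; rewrite ?inE; try exact: measurableI.
  by apply: setIS => x /=; rewrite !in_itv /= => /andP[-> /le_trans]; apply.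
have mU_ s t : a <= s -> s <= t -> `]s, t] `<=` U -> m s + (t - s) <= m t.
  move=> as_ st sU; rewrite -lee_fin EFinD !fineK //.
  have <- : mu `]s, t] = (t - s)%:E.
    have -> : mu `]s, t] = (if s < t then (t%:E - s%:E)%E else 0%E).
      by have := lebesgue_measure_itv `]s, t] => /= ->; rewrite lte_fin.
    by move: st; rewrite le_eqVlt => /orP[/eqP->|->]; rewrite ?ltxx ?subrr.
  rewrite -measureU //; last first.
    rewrite -subset0 => x [[_]] /=; rewrite !in_itv /= => /andP[_ h] /andP[h' _].
    by have := le_lt_trans h h'; rewrite ltxx.
  exact: measurableI.
  apply: le_measure; rewrite ?inE; [by apply: measurableU => //; exact: measurableI|by
    apply: measurableI|].
  move=> x [[Ux]|]/=; rewrite !in_itv /= => /andP[h1 h2].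
    by split => //; rewrite h1 (le_trans h2).
  split; first by apply: sU; rewrite /= in_itv /= h1.
  by rewrite h2 andbT (le_trans as_ (ltW h1)).
have : f b <= f a + eta * (b - a) + K * m b.
  apply: (@sup_induction (fun t => f t <= f a + eta * (t - a) + K * m t) a b ab).
  - by rewrite subrr mulr0 addr0 lerDl mulr_ge0 // ltW.
  - move=> t /andP[at_ tb] /(_ t) Pt.
    have {}Pt := Pt ltac:(by rewrite at_ lexx).
    (* Inside U, [m] grows at unit rate and [K * m] pays for the growth of f. Outside U the
       derivative is at most 0, so just after t the slope of f stays below eta. *)
    have [Ut|nUt] := pselect (U t).
      have [d /= d0 dU] := oU t Ut.
      exists (Num.min d (b - t)); first by rewrite lt_min d0 subr_gt0.
      move=> s /andP[ts]; rewrite -ltrBlDl lt_min => /andP[sd sb].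
      have h1 := mU_ t s at_ (ltW ts) _.
      have h2 := lip t s at_ (ltW ts) ltac:(lra).
      have {}h1 : m t + (s - t) <= m s.
        apply: h1 => x /=; rewrite in_itv /= => /andP[tx xs]; apply: dU.
        by rewrite /ball /= ltr0_norm ?subr_lt0 // opprB; lra.
      have : K * (m t + (s - t)) <= K * m s by rewrite ler_pM2l.
      have : eta * (t - a) <= eta * (s - a) by rewrite ler_pM2l // lerD2r ltW.
      lra.
    have nN' : ~ N' t by move=> /N'U.
    have at' : a < t.
      by rewrite lt_neqAle at_ andbT; apply/eqP => h; apply: nN'; right.
    have [dt Dt] : derivable f t 1 /\ 'D_1 f t <= 0.
      have nN : ~ N t by move=> h; apply: nN'; left.
      by apply: contrapT => h; apply: nN; apply: HN => /= h'; apply: h; apply: h';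
        rewrite at'.
    move/cvg_ex: dt => [l hl].
    have lE : 'D_1 f t = l by apply/cvg_lim.
    move: hl => /cvgrPdist_lt /(_ eta eta0) [d /= d0 hd].
    exists (Num.min d (b - t)); first by rewrite lt_min d0 subr_gt0.
    move=> s /andP[ts]; rewrite -ltrBlDl lt_min => /andP[sd sb].
    have st0 : 0 < s - t by rewrite subr_gt0.
    have := hd (s - t); rewrite /ball /= sub0r normrN gtr0_norm // => /(_ sd).
    move=> /(_ (lt0r_neq0 st0)); rewrite [_ *: 1]mulr1 subrK ltr_norml => /andP[h _].
    have : (s - t)^-1 * (f s - f t) < eta.
      rewrite -[_ * _]/(_ *: _); rewrite lE in Dt; lra.
    rewrite mulrC ltr_pdivrMr // => h3.
    have h4 := mmono t s (ltW ts).
    have : K * m t <= K * m s by rewrite ler_pM2l.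
    have -> : eta * (s - a) = eta * (s - t) + eta * (t - a) by ring.
    lra.
  - move=> t /andP[at_ tb] Ps; apply/ler_addgt0Pr => d d0.
    (* Within distance d / K of t, f gains at most d. *)
    pose s := Num.max a (t - d / K).
    have sa : a <= s by rewrite le_max lexx.
    have st : s < t by rewrite gt_max at_ /= ltrBlDr ltrDl divr_gt0.
    have hs := Ps s ltac:(by rewrite sa st).
    have h2 := lip s t sa (ltW st) tb.
    have h4 := mmono s t (ltW st).
    have h5 : K * m s <= K * m t by rewrite ler_pM2l.
    have h6 : K * (t - s) <= d.
      rewrite mulrC -ler_pdivlMr // lerBlDl -lerBlDr. by rewrite le_max lexx orbT.
    have : eta * (s - a) <= eta * (t - a) by rewrite ler_pM2l // lerD2r ltW.
    lra.
move=> /le_trans; apply; rewrite -addrA lerD2l.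
have h1 : K * m b <= e / 2 by rewrite mulrC -ler_pdivlMr.
have h2 : eta * (b - a) <= e / 2.
  have -> : e / 2 = eta * (b - a + 1) by rewrite /eta divfK // gt_eqF.
  by rewrite ler_pM2l // lerDl.
lra.
Qed.
End Lip.

(** * The twisted great-circle estimate *)

Section Lip2.
Variable R : realType.
Notation mu := (@lebesgue_measure R).
Implicit Types (f g : R -> R) (T : R).

Lemma ae_mono (P Q : R -> Prop) : (forall x, P x -> Q x) ->
  {ae mu, forall x, P x} -> {ae mu, forall x, Q x}.
Proof. by move=> PQ; apply: filterS => //; exact: (ae_filter_ringOfSetsType mu). Qed.

(** * Lipschitz calculus on [0, T] *)

Definition lip T f := exists K : R, forall s t, 0 <= s <= T -> 0 <= t <= T ->
  `|f s - f t| <= K * `|s - t|.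

Lemma lip_pos T f : lip T f -> exists2 K : R, 0 < K & forall s t, 0 <= s <= T -> 0 <= t
  <= T ->
  `|f s - f t| <= K * `|s - t|.
Proof.
move=> [K HK]; exists (`|K| + 1) => [|s t hs ht]; first by rewrite ltr_wpDl.
apply: (le_trans (HK _ _ hs ht)); rewrite ler_wpM2r //.
by rewrite (le_trans (ler_norm _)) // lerDl.
Qed.

Lemma lip_bounded T f : 0 <= T -> lip T f -> exists2 B : R, 0 < B & forall t, 0 <= t <=
  T -> `|f t| <= B.
Proof.
move=> T0 /lip_pos[K K0 HK]; exists (`|f 0| + K * T + 1).
  by rewrite ltr_wpDl // addr_ge0 // mulr_ge0 // ltW.
move=> t ht; have /(HK t 0 ht) : 0 <= (0 : R) <= T by rewrite lexx T0.
rewrite subr0; case/andP: ht => t0 tT; rewrite (ger0_norm t0).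
have := ler_normD (f t - f 0) (f 0); rewrite subrK.
have : K * t <= K * T by rewrite ler_pM2l.
lra.
Qed.

Lemma lip_cst T c : lip T (fun=> c).
Proof. by exists 0 => s t _ _; rewrite subrr normr0 mul0r. Qed.

Lemma lip_id T : lip T id.
Proof. by exists 1 => s t _ _; rewrite mul1r. Qed.

Lemma lipD T f g : lip T f -> lip T g -> lip T (fun t => f t + g t).
Proof.
move=> [K HK] [L HL]; exists (K + L) => s t hs ht.
rewrite opprD addrACA mulrDl; apply: (le_trans (ler_normD _ _)).
exact: lerD (HK _ _ hs ht) (HL _ _ hs ht).
Qed.

Lemma lipN T f : lip T f -> lip T (fun t => - f t).
Proof. by move=> [K HK]; exists K => s t hs ht; rewrite -opprD normrN; exact: HK. Qed.

Lemma lipB T f g : lip T f -> lip T g -> lip T (fun t => f t - g t).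
Proof. by move=> hf hg; apply: lipD => //; exact: lipN. Qed.

Lemma lipM T f g : 0 <= T -> lip T f -> lip T g -> lip T (fun t => f t * g t).
Proof.
move=> T0 hf hg; have [B B0 HB] := lip_bounded T0 hf; have [B' B'0 HB'] := lip_bounded
  T0 hg.
move: hf hg => [K HK] [L HL]; exists (K * B' + B * L) => s t hs ht.
have -> : f s * g s - f t * g t = (f s - f t) * g s + f t * (g s - g t) by ring.
apply: (le_trans (ler_normD _ _)); rewrite !normrM mulrDl; apply: lerD.
  by rewrite mulrAC ler_pM ?HK ?HB'.
by rewrite -mulrA ler_pM ?HL ?HB.
Qed.

Lemma lip_comp T f (h : R -> R) (D : set R) (L : R) : lip T f ->
  (forall t, 0 <= t <= T -> D (f t)) -> 0 <= L ->
  (forall x y, D x -> D y -> `|h x - h y| <= L * `|x - y|) ->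
  lip T (fun t => h (f t)).
Proof.
move=> [K HK] fD L0 HL; exists (L * K) => s t hs ht.
apply: (le_trans (HL _ _ (fD _ hs) (fD _ ht))).
by rewrite -mulrA ler_wpM2l // HK.
Qed.

Lemma lipschitz_of_derive (h dh : R -> R) (a b L : R) :
  (forall x, a <= x <= b -> is_derive x 1 h (dh x) /\ `|dh x| <= L) ->
  forall x y, a <= x <= b -> a <= y <= b -> `|h x - h y| <= L * `|x - y|.
Proof.
move=> H x y; wlog xy : x y / x <= y.
  by move=> W hx hy; case: (leP x y) => [|/ltW] le; [|rewrite distrC [`|x - y|]distrC];
    exact: W.
move=> hx hy.
have hz z : x <= z <= y -> a <= z <= b.
  by move: hx hy => /andP[h1 _] /andP[_ h2] /andP[h3 h4]; rewrite (le_trans h1) //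
    (le_trans h4).
have [||z zx e] := @MVT_segment R h dh x y xy.
- move=> z; rewrite in_itv /= => /andP[h1 h2]; apply: (H z (hz z _)).1.
  by rewrite !ltW.
- apply: derivable_within_continuous => z; rewrite in_itv /= => zxy.
  by have [? _] := H z (hz z zxy); exact: ex_derive.
rewrite distrC e [`|x - y|]distrC normrM ler_wpM2r //.
by apply: (H z _).2; apply: hz; rewrite in_itv in zx.
Qed.

Lemma lip_cos T f : lip T f -> lip T (fun t => cos (f t)).
Proof.
move=> hf; apply: (@lip_comp T f cos setT 1 hf) => // x y _ _.
apply: (@lipschitz_of_derive cos (fun x => - sin x) (Num.min x y) (Num.max x y)) => [z _||].
- split; first exact: is_derive_cos.
  by rewrite normrN ler_norml sin_geN1 sin_le1.
- by rewrite ge_min lexx le_max lexx.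
- by rewrite ge_min lexx orbT le_max lexx orbT.
Qed.

Lemma lip_sin T f : lip T f -> lip T (fun t => sin (f t)).
Proof.
move=> hf; apply: (@lip_comp T f sin setT 1 hf) => // x y _ _.
apply: (@lipschitz_of_derive sin cos (Num.min x y) (Num.max x y)) => [z _||].
- split; first exact: is_derive_sin.
  by rewrite ler_norml cos_geN1 cos_le1.
- by rewrite ge_min lexx le_max lexx.
- by rewrite ge_min lexx orbT le_max lexx orbT.
Qed.

Lemma subr_sqr_gt0 (l x : R) : 0 <= l < 1 -> `|x| <= l -> 0 < 1 - x ^+ 2.
Proof.
move=> /andP[l0 l1] xl; rewrite subr_gt0 -real_normK ?num_real // expr_lt1 //.
exact: le_lt_trans l1.
Qed.

(** The derivative of acos is unbounded near -1 and 1, but on |x| <= l it is at most 1 / sqrt (1 -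
    l^2). *)
Lemma lip_acos T f (l : R) : 0 <= l < 1 -> lip T f ->
  (forall t, 0 <= t <= T -> `|f t| <= l) -> lip T (fun t => acos (f t)).
Proof.
move=> l01 hf fl.
apply: (@lip_comp T f acos [set x | `|x| <= l] (Num.sqrt (1 - l ^+ 2))^-1 hf) => //.
move=> x y /=; rewrite ![`|_| <= l]ler_norml.
apply: (@lipschitz_of_derive _ (fun x => - (Num.sqrt (1 - x ^+ 2))^-1)) => z zl.
have zl' : `|z| <= l by rewrite ler_norml.
case/andP: (l01) => l0 l1.
split.
  apply: is_derive1_acos; rewrite -ltr_norml; exact: le_lt_trans l1.
rewrite normrN ger0_norm ?invr_ge0 ?sqrtr_ge0 //.
have ll : `|l| <= l by rewrite ger0_norm.
rewrite lef_pV2 ?posrE ?sqrtr_gt0 ?(subr_sqr_gt0 l01 zl') ?(subr_sqr_gt0 l01 ll) //.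
have zz : z ^+ 2 <= l ^+ 2 by rewrite -(real_normK (num_real z)) ler_pXn2r ?nnegrE.
by rewrite ler_wsqrtr // lerD2l lerN2.
Qed.

(** * The angle between a fixed unit vector and a twisted curve *)

Section Core.
Variable T : R.

(* The equation is the vanishing of the k-component of g^{-1} g', and
   4 |g'|^2 is the square of the sub-Riemannian speed, which L' dominates. *)
Definition hcurve (a b c d L : R -> R) :=
  [/\ [/\ lip T a, lip T b, lip T c, lip T d & lip T L],
      forall t, 0 <= t <= T -> nrm2 (a t) (b t) (c t) (d t) = 1 &
      {ae mu, forall t, 0 < t < T -> exists a' b' c' d' L',
        [/\ is_derive t 1 a a' /\ is_derive t 1 b b', is_derive t 1 c c',
            is_derive t 1 d d', is_derive t 1 L L' &
        [/\ a t * b' - b t * a' + d t * c' - c t * d' = 0,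
            0 <= L' & 4 * nrm2 a' b' c' d' <= L' ^+ 2]]}].

(* The Euclidean inner product of (q0, q1, q2, q3) with g e^{2 k L(t) kk}. *)
Definition twist (k : R) (a b c d L : R -> R) (q0 q1 q2 q3 : R) (t : R) : R :=
  q0 * (a t * cos (k * L t) - b t * sin (k * L t)) +
  q1 * (a t * sin (k * L t) + b t * cos (k * L t)) +
  q2 * (c t * cos (k * L t) + d t * sin (k * L t)) +
  q3 * (d t * cos (k * L t) - c t * sin (k * L t)).

(** A tangent vector u at h only sees the component w = q - x h of q orthogonal to h, whose squared
    norm is 1 - x^2; Cauchy-Schwarz for w and u concludes. *)
Lemma cauchy4 (q0 q1 q2 q3 h0 h1 h2 h3 u0 u1 u2 u3 : R) :
  nrm2 q0 q1 q2 q3 = 1 -> nrm2 h0 h1 h2 h3 = 1 ->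
  h0 * u0 + h1 * u1 + h2 * u2 + h3 * u3 = 0 ->
  (q0 * u0 + q1 * u1 + q2 * u2 + q3 * u3) ^+ 2 <=
  (1 - (q0 * h0 + q1 * h1 + q2 * h2 + q3 * h3) ^+ 2) * nrm2 u0 u1 u2 u3.
Proof.
move=> nq nh hu; set x := q0 * h0 + q1 * h1 + q2 * h2 + q3 * h3.
pose w0 := q0 - x * h0; pose w1 := q1 - x * h1; pose w2 := q2 - x * h2; pose w3 := q3 -
  x * h3.
have -> : q0 * u0 + q1 * u1 + q2 * u2 + q3 * u3 = w0 * u0 + w1 * u1 + w2 * u2 + w3 * u3.
  by rewrite -[LHS]subr0 -[0](mulr0 x) -hu /w0 /w1 /w2 /w3; ring.
have -> : 1 - x ^+ 2 = nrm2 w0 w1 w2 w3.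
  have -> : nrm2 w0 w1 w2 w3 = nrm2 q0 q1 q2 q3 - x ^+ 2 *+ 2 + x ^+ 2 * nrm2 h0 h1 h2 h3.
    by rewrite /nrm2 /w0 /w1 /w2 /w3 /x; ring.
  by rewrite nq nh; ring.
rewrite /nrm2 -subr_ge0.
(* Lagrange's identity: the defect in Cauchy-Schwarz is a sum of squares. *)
have -> : (w0 ^+ 2 + w1 ^+ 2 + w2 ^+ 2 + w3 ^+ 2) * (u0 ^+ 2 + u1 ^+ 2 + u2 ^+ 2 + u3
  ^+ 2) -
  (w0 * u0 + w1 * u1 + w2 * u2 + w3 * u3) ^+ 2 =
  (w0 * u1 - w1 * u0) ^+ 2 + (w0 * u2 - w2 * u0) ^+ 2 + (w0 * u3 - w3 * u0) ^+ 2 +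
  (w1 * u2 - w2 * u1) ^+ 2 + (w1 * u3 - w3 * u1) ^+ 2 + (w2 * u3 - w3 * u2) ^+ 2 by ring.
by rewrite !addr_ge0 ?sqr_ge0.
Qed.

Lemma nrm2_twist (a b c d x : R) :
  nrm2 (a * cos x - b * sin x) (a * sin x + b * cos x)
       (c * cos x + d * sin x) (d * cos x - c * sin x) = nrm2 a b c d.
Proof.
rewrite -[RHS]mulr1 -[1](cos2Dsin2 x) /nrm2; ring.
Qed.

Lemma twist_le1 k a b c d L q0 q1 q2 q3 t :
  nrm2 q0 q1 q2 q3 = 1 -> nrm2 (a t) (b t) (c t) (d t) = 1 ->
  `|twist k a b c d L q0 q1 q2 q3 t| <= 1.
Proof.
move=> nq nh; rewrite -(expr_le1 (n := 2)) // real_normK ?num_real //.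
rewrite -subr_ge0.
have nt := nrm2_twist (a t) (b t) (c t) (d t) (k * L t); rewrite nh in nt.
rewrite /twist.
move: nt; set h0 := (X in nrm2 X _ _ _); set h1 := (X in nrm2 _ X _ _);
  set h2 := (X in nrm2 _ _ X _); set h3 := (X in nrm2 _ _ _ X) => nt.
have -> : 1 - (q0 * h0 + q1 * h1 + q2 * h2 + q3 * h3) ^+ 2 =
  (q0 * h1 - q1 * h0) ^+ 2 + (q0 * h2 - q2 * h0) ^+ 2 + (q0 * h3 - q3 * h0) ^+ 2 +
  (q1 * h2 - q2 * h1) ^+ 2 + (q1 * h3 - q3 * h1) ^+ 2 + (q2 * h3 - q3 * h2) ^+ 2.
  by rewrite -[1]mulr1 -{1}nq -nt /nrm2; ring.
by rewrite !addr_ge0 ?sqr_ge0.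
Qed.

Lemma lip_twist k a b c d L q0 q1 q2 q3 : 0 <= T ->
  lip T a -> lip T b -> lip T c -> lip T d -> lip T L ->
  lip T (twist k a b c d L q0 q1 q2 q3).
Proof.
move=> T0 ha hb hc hd hL.
have hk : lip T (fun t => k * L t) by apply: lipM => //; exact: lip_cst.
have hcos := lip_cos hk; have hsin := lip_sin hk.
have M f g (hf : lip T f) (hg : lip T g) := lipM T0 hf hg.
have Z x f : lip T f -> lip T (fun t => x * f t) by move=> hf; exact: M (lip_cst T x) hf.
exact: (lipD (lipD (lipD (Z q0 _ (lipB (M _ _ ha hcos) (M _ _ hb hsin)))
  (Z q1 _ (lipD (M _ _ ha hsin) (M _ _ hb hcos))))
  (Z q2 _ (lipD (M _ _ hc hcos) (M _ _ hd hsin))))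
  (Z q3 _ (lipB (M _ _ hd hcos) (M _ _ hc hsin)))).
Qed.

Lemma is_derive_congr f (t f' f'' : R) : is_derive t 1 f f' -> f' = f'' -> is_derive t
  1 f f''.
Proof. by move=> h <-. Qed.

Lemma is_derive_add f g (t f' g' : R) : is_derive t 1 f f' -> is_derive t 1 g g' ->
  is_derive t 1 (fun s => f s + g s) (f' + g').
Proof. by move=> hf hg; exact: (is_deriveD hf hg). Qed.

Lemma is_derive_opp f (t f' : R) : is_derive t 1 f f' -> is_derive t 1 (fun s => - f s)
  (- f').
Proof. by move=> hf; exact: (is_deriveN hf). Qed.

Lemma is_derive_sub f g (t f' g' : R) : is_derive t 1 f f' -> is_derive t 1 g g' ->
  is_derive t 1 (fun s => f s - g s) (f' - g').
Proof. by move=> hf hg; exact: (is_derive_add hf (is_derive_opp hg)). Qed.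

Lemma is_derive_mul f g (t f' g' : R) : is_derive t 1 f f' -> is_derive t 1 g g' ->
  is_derive t 1 (fun s => f s * g s) (f t * g' + g t * f').
Proof. by move=> hf hg; exact: (is_deriveM hf hg). Qed.

Lemma is_derive_scal (x : R) f (t f' : R) : is_derive t 1 f f' ->
  is_derive t 1 (fun s => x * f s) (x * f').
Proof. by move=> hf; exact: (is_deriveZ x hf). Qed.

Lemma is_derive_sqr f (t f' : R) : is_derive t 1 f f' ->
  is_derive t 1 (fun s => f s ^+ 2) (2 * (f t * f')).
Proof.
move=> hf; have -> : (fun s => f s ^+ 2) = (fun s => f s * f s).
  by apply/funext => s; rewrite expr2.
refine (is_derive_congr (is_derive_mul hf hf) _).
by rewrite -mulr2n mulr_natl.
Qed.

Lemma is_derive_nrm2 (a b c d : R -> R) (t a' b' c' d' : R) :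
  is_derive t 1 a a' -> is_derive t 1 b b' -> is_derive t 1 c c' -> is_derive t 1 d d' ->
  (\forall s \near t, nrm2 (a s) (b s) (c s) (d s) = 1) ->
  a t * a' + b t * b' + c t * c' + d t * d' = 0.
Proof.
move=> ha hb hc hd h1.
have D : is_derive t 1 (fun s => nrm2 (a s) (b s) (c s) (d s))
    (2 * (a t * a' + b t * b' + c t * c' + d t * d')).
  rewrite /nrm2; refine (is_derive_congr (is_derive_add (is_derive_add (is_derive_add
    (is_derive_sqr ha) (is_derive_sqr hb)) (is_derive_sqr hc)) (is_derive_sqr hd)) _).
  ring.
have e := @near_eq_derive R R R _ (fun=> 1) t 1 h1.
rewrite (@derive_val _ _ _ _ _ _ _ D) in e.
move/eqP: e; rewrite (@derive_cst R R R).
by rewrite mulf_eq0 pnatr_eq0 /= => /eqP.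
Qed.

(** In each coordinate the first two terms come from rotating the velocity of the curve; the term
    with [k * L'] is the derivative of the rotation. *)
Lemma is_derive_twist k a b c d L q0 q1 q2 q3 (t a' b' c' d' L' : R) :
  is_derive t 1 a a' -> is_derive t 1 b b' -> is_derive t 1 c c' -> is_derive t 1 d d' ->
  is_derive t 1 L L' ->
  is_derive t 1 (twist k a b c d L q0 q1 q2 q3)
  (q0 * (a' * cos (k * L t) - b' * sin (k * L t) - k * L' * (a t * sin (k * L t) + b t
    * cos (k * L t))) +
   q1 * (a' * sin (k * L t) + b' * cos (k * L t) + k * L' * (a t * cos (k * L t) - b t
     * sin (k * L t))) +
   q2 * (c' * cos (k * L t) + d' * sin (k * L t) + k * L' * (d t * cos (k * L t) - c t
     * sin (k * L t))) +
   q3 * (d' * cos (k * L t) - c' * sin (k * L t) - k * L' * (c t * cos (k * L t) + d t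
     * sin (k * L t)))).
Proof.
move=> ha hb hc hd hL.
have hk : is_derive t 1 (fun t => k * L t) (k * L').
  exact: is_derive_scal.
have hcos : is_derive t 1 (fun t => cos (k * L t)) (- sin (k * L t) * (k * L')).
  exact: (@is_derive1_comp _ cos (fun t => k * L t)).
have hsin : is_derive t 1 (fun t => sin (k * L t)) (cos (k * L t) * (k * L')).
  exact: (@is_derive1_comp _ sin (fun t => k * L t)).
rewrite /twist; refine (is_derive_congr (is_derive_add (is_derive_add (is_derive_add
   (is_derive_scal q0 (is_derive_sub (is_derive_mul ha hcos) (is_derive_mul hb hsin)))
   (is_derive_scal q1 (is_derive_add (is_derive_mul ha hsin) (is_derive_mul hb hcos))))
   (is_derive_scal q2 (is_derive_add (is_derive_mul hc hcos) (is_derive_mul hd hsin))))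
   (is_derive_scal q3 (is_derive_sub (is_derive_mul hd hcos) (is_derive_mul hc hsin)))) _).
ring.
Qed.

(* The factor l < 1 keeps the argument of acos away from its singularities
   -1 and 1; l tends to 1 in cos_le_twist. *)
Lemma angle_bound k a b c d L q0 q1 q2 q3 s t l :
  hcurve a b c d L -> nrm2 q0 q1 q2 q3 = 1 -> 0 <= s -> s <= t -> t <= T -> 0 < l < 1 ->
  `|acos (l * twist k a b c d L q0 q1 q2 q3 t) - acos (l * twist k a b c d L q0 q1 q2 q3 s)|
  <= Num.sqrt (4^-1 + k ^+ 2) * (L t - L s).
Proof.
move=> [[la lb lc ld lL] n1 hae] nq s0 st tT /andP[l0 l1].
have T0 : 0 <= T by rewrite (le_trans s0) // (le_trans st).
(* On the unit 3-sphere the horizontal velocity has norm at most L' / 2 and the twist adds k L'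
   orthogonally, so w L' bounds the speed of the twisted curve. *)
set x := twist _ _ _ _ _ _ _ _ _ _; set w := Num.sqrt _.
have w0 : 0 <= w by exact: sqrtr_ge0.
have w2 : w ^+ 2 = 4^-1 + k ^+ 2.
  by rewrite sqr_sqrtr // addr_ge0 ?sqr_ge0.
have lx : lip T x by exact: lip_twist.
have x1 u : 0 <= u <= T -> `|x u| <= 1 by move=> hu; exact: twist_le1 nq (n1 _ hu).
have lxl u : 0 <= u <= T -> `|l * x u| <= l.
  by move=> hu; rewrite normrM gtr0_norm // ler_piMr ?x1 // ltW.
have l01 : 0 <= l < 1 by rewrite ltW.
have lac : lip T (fun u => acos (l * x u)).
  by apply: (@lip_acos T _ l l01) => //; apply: lipM => //; exact: lip_cst.
(* The signs e = 1 and e = -1 yield the two halves of the absolute value. *)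
have key e : e ^+ 2 = 1 -> e * acos (l * x t) - w * L t <= e * acos (l * x s) - w * L s.
  move=> e2.
  have : lip T (fun u => e * acos (l * x u) - w * L u).
    by apply: lipB; apply: lipM => //; exact: lip_cst.
  move=> /lip_pos[K K0 HK].
  apply: (@lipschitz_ae_noninc R (fun u => e * acos (l * x u) - w * L u) K s t st).
    move=> u v su uv vt; rewrite -(ger0_norm (_ : 0 <= v - u)) ?subr_ge0 //.
    apply: (le_trans (ler_norm _)); apply: HK.
      by apply/andP; split; lra.
    by apply/andP; split; lra.
  apply: ae_mono hae => u hu /andP[su ut].
  have uT : 0 < u < T by rewrite (le_lt_trans s0 su) (lt_le_trans ut).
  have uT' : 0 <= u <= T by move: uT => /andP[? ?]; rewrite !ltW.
  have [a' [b' [c' [d' [L' [[da db] dc dd dL [hor L0 sp]]]]]]] := hu uT.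
  have gg : a u * a' + b u * b' + c u * c' + d u * d' = 0.
    apply: is_derive_nrm2 => //.
    have : \forall v \near u, v \in `]0, T[ by apply: near_in_itvoo; rewrite in_itv.
    apply: filterS => v; rewrite in_itv /= => /andP[? ?]; apply: n1; by rewrite !ltW.
  have dx := is_derive_twist k q0 q1 q2 q3 da db dc dd dL.
  rewrite -/x in dx.
  set x' := (X in is_derive _ _ _ X) in dx.
  have x'2 : x' ^+ 2 <= (1 - x u ^+ 2) * (w * L') ^+ 2.
    have nt := nrm2_twist (a u) (b u) (c u) (d u) (k * L u).
    rewrite (n1 _ uT') in nt.
    have := cauchy4 nq nt _; rewrite -/(twist k a b c d L q0 q1 q2 q3 u) -/x.
    set C := cos (k * L u); set S := sin (k * L u).
    have CS : C ^+ 2 + S ^+ 2 = 1 by exact: cos2Dsin2.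
    set u0 := a' * C - b' * S - k * L' * (a u * S + b u * C).
    set u1 := a' * S + b' * C + k * L' * (a u * C - b u * S).
    set u2 := c' * C + d' * S + k * L' * (d u * C - c u * S).
    set u3 := d' * C - c' * S - k * L' * (c u * C + d u * S).
    move=> /(_ u0 u1 u2 u3) cau.
    have -> : x' = q0 * u0 + q1 * u1 + q2 * u2 + q3 * u3 by [].
    apply: le_trans (cau _) _.
      rewrite -[RHS](mulr0 (C ^+ 2 + S ^+ 2)) -gg /u0 /u1 /u2 /u3; ring.
    apply: ler_wpM2l.
      by rewrite subr_ge0 -real_normK ?num_real // expr_le1 // x1.
    (* The last bracket, the interaction of velocity and twist, is the k-component of g^{-1} g' and
       vanishes by [hor]. *)
    have -> : nrm2 u0 u1 u2 u3 = (C ^+ 2 + S ^+ 2) * (nrm2 a' b' c' d' + (k * L') ^+ 2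
      * nrm2 (a u) (b u) (c u) (d u) +
      2 * (k * L') * (a u * b' - b u * a' + d u * c' - c u * d')).
      by rewrite /nrm2 /u0 /u1 /u2 /u3; ring.
    rewrite CS n1 // hor mulr0 addr0 mul1r mulr1 !exprMn w2.
    have -> : (4^-1 + k ^+ 2) * L' ^+ 2 = 4^-1 * L' ^+ 2 + k ^+ 2 * L' ^+ 2 by ring.
    by rewrite lerD2r -ler_pdivrMl ?invr_gt0 // invrK.
  have lxu : `|l * x u| <= l by exact: lxl.
  have sq0 := subr_sqr_gt0 l01 lxu.
  have dac : is_derive u 1 (fun u => acos (l * x u)) (- (Num.sqrt (1 - (l * x u) ^+
    2))^-1 * (l * x')).
    have acl : is_derive (l * x u) 1 (@acos R) (- (Num.sqrt (1 - (l * x u) ^+ 2))^-1).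
      by apply: is_derive1_acos; rewrite -ltr_norml; exact: le_lt_trans l1.
    exact: (@is_derive1_comp _ acos (fun u => l * x u) u _ _ acl (is_derive_scal l dx)).
  have D := is_derive_sub (is_derive_scal e dac) (is_derive_scal w dL).
  split; first exact: ex_derive.
  rewrite (@derive_val _ _ _ _ _ _ _ D) subr_le0.
  apply: (le_trans (ler_norm _)).
  rewrite -(ler_pXn2r (n := 2)) ?nnegrE ?mulr_ge0 // real_normK ?num_real //.
  set q := 1 - (l * x u) ^+ 2 in sq0 *.
  have -> : (e * (- (Num.sqrt q)^-1 * (l * x'))) ^+ 2 = e ^+ 2 * (l ^+ 2 * x' ^+ 2) /
    Num.sqrt q ^+ 2.
    by rewrite -exprVn; ring.
  rewrite e2 mul1r sqr_sqrtr ?(ltW sq0) // ler_pdivrMr //.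
  (* What remains is l^2 (1 - x^2) <= 1 - l^2 x^2, true since l^2 <= 1. *)
  apply: (@le_trans _ _ (l ^+ 2 * ((1 - x u ^+ 2) * (w * L') ^+ 2))).
    by rewrite ler_wpM2l ?sqr_ge0.
  rewrite mulrA [leRHS]mulrC ler_wpM2r ?sqr_ge0 // /q exprMn mulrBr mulr1 lerD2r.
  by rewrite expr_le1 // ltW.
rewrite ler_norml mulrBr; apply/andP; split.
  by have := key (-1) ltac:(by rewrite sqrrN expr1n); lra.
by have := key 1 ltac:(by rewrite expr1n); lra.
Qed.

(** The limit of [angle_bound] as l tends to 1, for a twisted curve that leaves q at time s or
    reaches q at time t: its angle to q is at most its spherical length. The bound by pi keeps this
    length in the range where cosine decreases. *)
Lemma cos_le_twist k a b c d L q0 q1 q2 q3 s t :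
  hcurve a b c d L -> nrm2 q0 q1 q2 q3 = 1 -> 0 <= s -> s <= t -> t <= T ->
  0 <= L t - L s -> Num.sqrt (4^-1 + k ^+ 2) * (L t - L s) <= pi ->
  let x := twist k a b c d L q0 q1 q2 q3 in
  (x s = 1 -> cos (Num.sqrt (4^-1 + k ^+ 2) * (L t - L s)) <= x t) /\
  (x t = 1 -> cos (Num.sqrt (4^-1 + k ^+ 2) * (L t - L s)) <= x s).
Proof.
move=> hc nq s0 st tT Lst; set w := Num.sqrt _ * _ => wpi x.
have w0 : 0 <= w by rewrite mulr_ge0 // sqrtr_ge0.
have n1 := let: And3 _ h _ := hc in h.
have x1 u : 0 <= u <= T -> `|x u| <= 1 by move=> hu; exact: twist_le1 nq (n1 _ hu).
have hs : 0 <= s <= T by rewrite s0 (le_trans st).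
have ht : 0 <= t <= T by rewrite tT (le_trans s0).
have key u v : `|x u| <= 1 -> `|x v| <= 1 ->
  (forall l, 0 < l < 1 -> `|acos (l * x u) - acos (l * x v)| <= w) -> x v = 1 -> cos w
    <= x u.
  move=> xu xv H v1; rewrite leNgt; apply/negP => lt.
  have cw1 := cos_le1 w.
  have xuN : -1 <= x u by move: xu; rewrite ler_norml => /andP[].
  have cwN : - cos w < 1 by lra.
  set e := cos w - x u; have e0 : 0 < e by rewrite subr_gt0.
  set r := (Num.sqrt (1 + e ^+ 2))^-1.
  have e20 : 0 < e ^+ 2 by rewrite exprn_gt0.
  have sq1 : 1 < Num.sqrt (1 + e ^+ 2).
    by rewrite -[X in X < _]sqrtr1 ltr_sqrt ?ltrDl // addr_gt0.
  have r0 : 0 < r by rewrite invr_gt0 (lt_trans _ sq1).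
  have r1 : r < 1 by rewrite invf_lt1 // (lt_trans _ sq1).
  (* l > r makes l e exceed sqrt (1 - l^2), contrary to what the angle bound will give; l > - cos w
     keeps acos l + w in [0, pi], where cosine can be compared. *)
  pose m := Num.max r (- cos w); pose l := (m + 1) / 2.
  have m1 : m < 1 by rewrite gt_max r1.
  have lm : m < l by rewrite /l; lra.
  have l1 : l < 1 by rewrite /l; lra.
  have rl : r < l by apply: le_lt_trans lm; rewrite le_max lexx.
  have cl : - cos w < l by apply: le_lt_trans lm; rewrite le_max lexx orbT.
  have l0 : 0 < l by exact: lt_trans rl.
  have l1' : -1 <= l <= 1 by rewrite (ltW l1) andbT; lra.
  have := H l ltac:(by rewrite l0); rewrite v1 mulr1 => /(le_trans (ler_norm _)) Hl.
  have lxu : -1 <= l * x u <= 1.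
    by rewrite -ler_norml normrM gtr0_norm // mulr_ile1 // ltW.
  have hl : acos l <= pi - w.
    rewrite -[X in _ <= X](@cosK R) ?in_itv /=; last by rewrite subr_ge0 wpi gerBl.
    have hN : cos (pi - w) = - cos w by rewrite addrC cosDpi cosN.
    rewrite hN leNgt; apply/negP => h.
    have : cos (acos l) < cos (acos (- cos w)).
      rewrite ltr_cos // in_itv /= acos_ge0 ?acos_lepi // -hN cos_geN1 cos_le1 //.
    rewrite !acosK ?in_itv //= -?hN ?cos_geN1 ?cos_le1 // hN => h'.
    by have := lt_trans h' cl; rewrite ltxx.
  have : cos (acos l + w) <= cos (acos (l * x u)).
    have al := acos_ge0 l1'.
    rewrite leNgt ltr_cos ?in_itv /= ?acos_ge0 ?acos_lepi // -?leNgt; first lra.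
    by apply/andP; split; lra.
  rewrite cosD !acosK ?in_itv //= sin_acos //.
  have s1 : sin w <= 1 by exact: sin_le1.
  have sl0 := sqrtr_ge0 (1 - l ^+ 2).
  have : Num.sqrt (1 - l ^+ 2) * sin w <= Num.sqrt (1 - l ^+ 2) by rewrite ler_piMr.
  move=> h1 h2.
  have : l * e <= Num.sqrt (1 - l ^+ 2) by rewrite /e mulrBr; lra.
  have l20 : 0 <= 1 - l ^+ 2 by rewrite subr_ge0 expr_le1 // ltW.
  have le0 : 0 <= l * e by rewrite mulr_ge0 // ltW.
  move=> h3.
  have : (l * e) ^+ 2 <= Num.sqrt (1 - l ^+ 2) ^+ 2 by rewrite ler_pXn2r ?nnegrE.
  rewrite sqr_sqrtr // exprMn leNgt => /negP; apply.
  suff : 1 < l ^+ 2 * (1 + e ^+ 2) by rewrite mulrDr mulr1; lra.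
  rewrite -ltr_pdivrMr ?addr_gt0 // mul1r.
  have -> : (1 + e ^+ 2)^-1 = r ^+ 2.
    by rewrite /r exprVn sqr_sqrtr // addr_ge0 // ltW.
  by rewrite ltr_pXn2r ?nnegrE // ltW.
split=> x1'.
  apply: (key t s) => //; try exact: x1.
  by move=> l hl; exact: angle_bound.
apply: (key s t) => //; try exact: x1.
by move=> l hl; rewrite distrC; exact: angle_bound.
Qed.

End Core.

End Lip2.

(** * Geodesic endpoints *)

Section Geo.
Variable R : realType.
Notation mu := (@lebesgue_measure R).
Implicit Types (f g : R -> R) (T : R).

(* The complex number (cos x + i s sin x) e^{-isx}, the first matrix entry of
   e^{t (p + c k)} e^{-t c k} with p in the unit circle of p, s = c / sqrt (1 + c^2)
   and x = t sqrt (1 + c^2) / 2; such a curve has length 2 x sqrt (1 - s^2). *)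
Definition endA (s x : R) := cos x * cos (s * x) + s * sin x * sin (s * x).
Definition endB (s x : R) := s * sin x * cos (s * x) - cos x * sin (s * x).

(** Multiplication by e^{isx} cancels the factor e^{-isx} of [endA + i endB]. *)
Lemma end_twist (s x : R) : endA s x * cos (s * x) - endB s x * sin (s * x) = cos x /\
  endA s x * sin (s * x) + endB s x * cos (s * x) = s * sin x.
Proof.
have CS := cos2Dsin2 (s * x); rewrite /endA /endB; move: (cos (s * x)) (sin (s * x)) CS
  => C S CS.
split.
  transitivity (cos x * (C ^+ 2 + S ^+ 2)); [ring|by rewrite CS mulr1].
transitivity (s * sin x * (C ^+ 2 + S ^+ 2)); [ring|by rewrite CS mulr1].
Qed.

(** For an element of SU(2) with this first entry the subtracted term is |beta|^2, so beta = 0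
    exactly when sin x = 0 or s^2 = 1. *)
Lemma end_norm (s x : R) : endA s x ^+ 2 + endB s x ^+ 2 = 1 - (1 - s ^+ 2) * sin x ^+ 2.
Proof.
have CS := cos2Dsin2 (s * x); have cs := cos2Dsin2 x.
rewrite /endA /endB; move: (cos (s * x)) (sin (s * x)) CS => C S CS.
transitivity ((cos x ^+ 2 + s ^+ 2 * sin x ^+ 2) * (C ^+ 2 + S ^+ 2)); first ring.
have -> : cos x ^+ 2 = 1 - sin x ^+ 2 by rewrite -cs addrK.
by rewrite CS; ring.
Qed.

(** The first matrix entry suffices, because rotating the initial direction in p changes only the
    phase of beta. For |s| < 1, beta first returns to 0 at x = pi, where all geodesics with the same
    s meet. The values s = 1 and s = -1 give the entry 1 with length 0. *)
Definition reach (a b l : R) := exists s x, [/\ -1 <= s <= 1, 0 <= x <= pi,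
  a = endA s x, b = endB s x & l = 2 * x * Num.sqrt (1 - s ^+ 2)].

Lemma reach_ge0 a b l : reach a b l -> 0 <= l.
Proof. by move=> [s [x [_ /andP[x0 _] _ _ ->]]]; rewrite !mulr_ge0 // sqrtr_ge0. Qed.

Lemma reachN a b l : reach a b l -> reach a (- b) l.
Proof.
move=> [s [x [/andP[h1 h2] hx -> -> ->]]]; exists (- s), x; split => //.
- by apply/andP; split; lra.
- by rewrite /endA mulNr cosN sinN; ring.
- by rewrite /endB !mulNr cosN sinN; ring.
- by rewrite sqrrN.
Qed.

(** Put cos x + i s sin x = r e^{ih}. For r < 1, h determines x and s, and the argument of the entry
    is h - s x. This is continuous in h and equals -pi and pi at h = -pi and pi, so the intermediate
    value theorem reaches every p. *)
Lemma reach_surj a b : a ^+ 2 + b ^+ 2 <= 1 -> exists l, reach a b l.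
Proof.
have [p ppi [aE bE]] := polar a b; set r := Num.sqrt _ in aE bE.
move=> ab1.
have r0 : 0 <= r by exact: sqrtr_ge0.
have r1 : r <= 1 by rewrite -sqrtr1 ler_wsqrtr.
have pi0 := pi_gt0 R.
(* For r = 1 take x = pi, where the entry is -e^{-i s pi}; the sign of p decides which of 1 - p / pi
   and -1 - p / pi lies in [-1, 1]. *)
have [r1'|r1'] := eqVneq r 1.
  rewrite r1' !mul1r in aE bE.
  have [p0|p0] := leP 0 p.
    exists (2 * pi * Num.sqrt (1 - (1 - p / pi) ^+ 2)), (1 - p / pi), pi.
    have e : (1 - p / pi) * pi = - p + pi by rewrite mulrBl divfK ?gt_eqF // mul1r addrC.
    split=> //.
    - have : 0 <= p / pi by rewrite divr_ge0 // ltW.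
      have : p / pi <= 1 by rewrite ler_pdivrMr // mul1r; case/andP: ppi.
      by move=> ? ?; apply/andP; split; lra.
    - by rewrite lexx ltW.
    - by rewrite /endA e cosDpi sinDpi cospi sinpi cosN sinN aE; ring.
    - by rewrite /endB e cosDpi sinDpi cospi sinpi cosN sinN bE; ring.
  exists (2 * pi * Num.sqrt (1 - (- 1 - p / pi) ^+ 2)), (- 1 - p / pi), pi.
  have e : (- 1 - p / pi) * pi = - (p + pi) by rewrite mulrBl divfK ?gt_eqF // mulN1r; ring.
  split=> //.
  - have : p / pi <= 0 by rewrite ler_pdivrMr // mul0r ltW.
    have : -1 <= p / pi by rewrite ler_pdivlMr // mulN1r; case/andP: ppi.
    by move=> ? ?; apply/andP; split; lra.
  - by rewrite lexx ltW.
  - by rewrite /endA e cosN sinN cosDpi sinDpi cospi sinpi aE; ring.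
  - by rewrite /endB e cosN sinN cosDpi sinDpi cospi sinpi bE; ring.
have {r1'} r1 : r < 1 by rewrite lt_neqAle r1' r1.
pose xx h := acos (r * cos h).
pose vv h := Num.sqrt (1 - (r * cos h) ^+ 2).
pose ss h := r * sin h / vv h.
pose th h := h - ss h * xx h.
have rc h : `|r * cos h| <= r.
  by rewrite normrM ger0_norm // ler_piMr // ler_norml cos_geN1 cos_le1.
have r01 : 0 <= r < 1 by rewrite r0.
have v0 h : 0 < vv h by rewrite sqrtr_gt0; exact: subr_sqr_gt0 r01 (rc h).
have rc1 h : -1 < r * cos h < 1 by rewrite -ltr_norml; exact: le_lt_trans r1.
have cth : continuous th.
  move=> h; apply: cvgB; first exact: cvg_id.
  have crc : {for h, continuous (fun h => r * cos h)}.
    by apply: cvgM; [exact: cvg_cst|exact: continuous_cos].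
  apply: cvgM.
    apply: cvgM.
      by apply: cvgM; [exact: cvg_cst|exact: continuous_sin].
    apply: cvgV; first by rewrite gt_eqF // v0.
    apply: (@continuous_comp _ _ _ (fun h => 1 - (r * cos h) ^+ 2) Num.sqrt); last
      exact: sqrt_continuous.
    by apply: cvgB; [exact: cvg_cst|rewrite expr2; under eq_fun do rewrite expr2;
      exact: cvgM].
  apply: (@continuous_comp _ _ _ (fun h => r * cos h) acos) => //.
  exact: continuous_acos.
have [|||h hpi thE] := @IVT R th (- pi) pi p.
- by lra.
- exact: continuous_subspaceT.
- have -> : th pi = pi by rewrite /th /ss sinpi mulr0 !mul0r subr0.
  have -> : th (- pi) = - pi by rewrite /th /ss sinN sinpi oppr0 mulr0 !mul0r subr0.
  by rewrite ge_min le_max; case/andP: ppi => -> ->; rewrite orbT.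
have ss1 : -1 <= ss h <= 1.
  rewrite -ler_norml /ss normrM normfV (gtr0_norm (v0 h)) ler_pdivrMr // mul1r.
  rewrite -(ler_pXn2r (n := 2)) ?nnegrE ?(ltW (v0 h)) // real_normK ?num_real //.
  rewrite sqr_sqrtr ?(ltW (subr_sqr_gt0 r01 (rc h))) //.
  by rewrite !exprMn lerBrDr -mulrDr addrC cos2Dsin2 mulr1 expr_le1 // ltW.
have cx : cos (xx h) = r * cos h by rewrite acosK // in_itv /= !ltW //; case/andP: (rc1 h).
have sx : sin (xx h) = vv h by rewrite sin_acos //; case/andP: (rc1 h) => ? ?; rewrite !ltW.
have sv : ss h * vv h = r * sin h by rewrite divfK // gt_eqF.
have hE : ss h * xx h = h - p by rewrite -thE /th; ring.
exists (2 * xx h * Num.sqrt (1 - ss h ^+ 2)); exists (ss h); exists (xx h).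
split => //.
- by case/andP: (rc1 h) => ? ?; rewrite acos_ge0 ?acos_lepi // !ltW.
- rewrite /endA cx sx sv hE aE cosB sinB -[LHS]mulr1 -(cos2Dsin2 h); ring.
- rewrite /endB cx sx sv hE bE cosB sinB -[LHS]mulr1 -(cos2Dsin2 h); ring.
Qed.

(* Twisting with k = s x / L T moves the first coordinate of the end point to cos x. *)
Lemma hcurve_lower T a b c d L (l : R) : 0 <= T -> hcurve T a b c d L ->
  a 0 = 1 -> b 0 = 0 -> L 0 = 0 -> 0 < L T -> reach (a T) (b T) l -> l <= L T.
Proof.
move=> T0 hc a0 b0 L0 LT [s [x [s1 /andP[x0 xpi] aE bE ->]]].
set k := s * x / L T.
have kL : k * L T = s * x by rewrite divfK // gt_eqF.
have n1 : nrm2 1 0 0 0 = 1 :> R by rewrite /nrm2; ring.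
set w := Num.sqrt (4^-1 + k ^+ 2).
have w0 : 0 <= w by exact: sqrtr_ge0.
have wL : x <= w * L T.
  have [|wpi] := leP (w * L T) pi; last by lra.
  move=> wpi.
  have x0E : twist k a b c d L 1 0 0 0 0 = 1.
    by rewrite /twist a0 b0 L0 mulr0 cos0 sin0; ring.
  have xTE : twist k a b c d L 1 0 0 0 T = cos x.
    by rewrite /twist kL aE bE (end_twist s x).1; ring.
  have := cos_le_twist hc n1 (lexx 0) T0 (lexx T).
  rewrite L0 subr0 => /(_ k (ltW LT) wpi) [+ _]; rewrite xTE => /(_ x0E).
  rewrite -/w leNgt ltr_cos ?in_itv /= ?x0 ?xpi ?wpi ?mulr_ge0 ?(ltW LT) //.
  by rewrite leNgt.
have w2 : w ^+ 2 = 4^-1 + k ^+ 2 by rewrite sqr_sqrtr // addr_ge0 ?sqr_ge0.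
have s2 : 0 <= 1 - s ^+ 2 by rewrite subr_ge0 -real_normK ?num_real // expr_le1 //
  ler_norml.
rewrite -(ler_pXn2r (n := 2)) ?nnegrE ?mulr_ge0 ?sqrtr_ge0 ?(ltW LT) //.
rewrite exprMn sqr_sqrtr //.
(* As k L T = s x, this reads x^2 <= (L T)^2 / 4 + (s x)^2, free of k. *)
have : x ^+ 2 <= (w * L T) ^+ 2 by rewrite ler_pXn2r ?nnegrE ?mulr_ge0 // ltW.
rewrite exprMn w2 mulrDl -exprMn kL => h.
have -> : (2 * x) ^+ 2 * (1 - s ^+ 2) = 4 * (x ^+ 2 - (s * x) ^+ 2) by ring.
lra.
Qed.

(* Equality in the triangle inequality on the 3-sphere. *)
Lemma great_circle (q0 q1 q2 q3 h0 h1 h2 h3 x w : R) :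
  nrm2 q0 q1 q2 q3 = 1 -> nrm2 h0 h1 h2 h3 = 1 -> q0 = cos x ->
  0 <= w <= x -> 0 < x < pi ->
  cos w <= h0 -> cos (x - w) <= q0 * h0 + q1 * h1 + q2 * h2 + q3 * h3 ->
  [/\ sin x * h0 = sin (x - w) + sin w * q0, sin x * h1 = sin w * q1,
      sin x * h2 = sin w * q2 & sin x * h3 = sin w * q3].
Proof.
move=> nq nh qx /andP[w0 wx] /andP[x0 xpi] hw hxw.
have sw : 0 <= sin w by apply: sin_ge0_pi; lra.
have sxw : 0 <= sin (x - w) by apply: sin_ge0_pi; lra.
have sx : 0 < sin x by apply: sin_gt0_pi; lra.
have xE : sin x = sin (x - w) * cos w + cos (x - w) * sin w by rewrite -sinD subrK.
have cE : cos x = cos (x - w) * cos w - sin (x - w) * sin w by rewrite -cosD subrK.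
have cs1 := cos2Dsin2 w; have cs2 := cos2Dsin2 (x - w).
set S := sin (x - w) in xE cE cs2 sxw *; set C := cos (x - w) in xE cE cs2 hxw.
(* The vector d compares sin x times h with sin (x - w) times 1 plus sin w times q, the spherical
   interpolation from 1 to q; its squared norm turns out to be at most 0. *)
set d0 := sin x * h0 - (S + sin w * q0).
set d1 := sin x * h1 - sin w * q1.
set d2 := sin x * h2 - sin w * q2.
set d3 := sin x * h3 - sin w * q3.
have nd : nrm2 d0 d1 d2 d3 <= 0.
  have -> : nrm2 d0 d1 d2 d3 = sin x ^+ 2 * nrm2 h0 h1 h2 h3
    - 2 * sin x * (S * h0 + sin w * (q0 * h0 + q1 * h1 + q2 * h2 + q3 * h3))
    + (S ^+ 2 + 2 * S * sin w * q0 + sin w ^+ 2 * nrm2 q0 q1 q2 q3).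
    by rewrite /nrm2 /d0 /d1 /d2 /d3; ring.
  rewrite nq nh !mulr1 qx.
  have -> : S ^+ 2 + 2 * S * sin w * cos x + sin w ^+ 2 = sin x ^+ 2.
    have -> : sin x ^+ 2 = S ^+ 2 * cos w ^+ 2 + C ^+ 2 * sin w ^+ 2 + 2 * S * C * cos
      w * sin w.
      by rewrite xE; ring.
    have -> : cos w ^+ 2 = 1 - sin w ^+ 2 by rewrite -cs1; ring.
    have -> : C ^+ 2 = 1 - S ^+ 2 by rewrite -cs2; ring.
    by rewrite cE; ring.
  have e1 : S * cos w <= S * h0 by rewrite ler_wpM2l.
  have := ler_wpM2l sw hxw; set z := q0 * h0 + _ => e2.
  have e3 : sin x <= S * h0 + sin w * (cos x * h0 + q1 * h1 + q2 * h2 + q3 * h3).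
    by rewrite -qx -/z xE [C * _]mulrC; lra.
  have := ler_wpM2l (ltW sx) e3; lra.
have : nrm2 d0 d1 d2 d3 = 0.
  by apply/le_anti; rewrite nd !addr_ge0 ?sqr_ge0.
move/eqP; rewrite /nrm2 !paddr_eq0 ?addr_ge0 ?sqr_ge0 // !sqrf_eq0.
by case/andP=> /andP[/andP[/eqP h00 /eqP h11] /eqP h22] /eqP h33; split; apply/eqP;
  rewrite -subr_eq0; apply/eqP.
Qed.

End Geo.

(** * Uniqueness of minimizers *)

Section Geo2.
Variable R : realType.
Notation mu := (@lebesgue_measure R).
Implicit Types (f g : R -> R) (T : R).

(** The value of T gives T^2 / 4 + (s x)^2 = x^2. Twisted by k = s x / T, the curve therefore has
    spherical length at most x and joins 1 to a point at distance x, so [great_circle] applies at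
    every time. *)
Lemma hcurve_great_circle T a b c d s x : 0 < T -> hcurve T a b c d id ->
  a 0 = 1 -> b 0 = 0 -> a T = endA s x -> b T = endB s x -> -1 <= s <= 1 -> 0 < x < pi ->
  T = 2 * x * Num.sqrt (1 - s ^+ 2) ->
  forall t, 0 <= t <= T ->
  let C := cos (s * x / T * t) in let S := sin (s * x / T * t) in
  let w := x / T * t in
  let CT := cos (s * x) in let ST := sin (s * x) in
  [/\ sin x * (a t * C - b t * S) = sin (x - w) + sin w * (a T * CT - b T * ST),
      sin x * (a t * S + b t * C) = sin w * (a T * ST + b T * CT),
      sin x * (c t * C + d t * S) = sin w * (c T * CT + d T * ST) &
      sin x * (d t * C - c t * S) = sin w * (d T * CT - c T * ST)].
Proof.
move=> T0 hc a0 b0 aT bT s1 /andP[x0 xpi] TE t /andP[t0 tT] C S w CT ST.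
have T0' := ltW T0.
have n1 := let: And3 _ h _ := hc in h.
set k := s * x / T.
have kT : k * T = s * x by rewrite divfK // gt_eqF.
have s2 : 0 <= 1 - s ^+ 2 by rewrite subr_ge0 -real_normK ?num_real // expr_le1 //
  ler_norml.
have wE : Num.sqrt (4^-1 + k ^+ 2) = x / T.
  have -> : 4^-1 + k ^+ 2 = (x / T) ^+ 2.
    apply: (@mulIf _ (T ^+ 2)); first by rewrite sqrf_eq0 gt_eqF.
    rewrite mulrDl -!exprMn kT divfK ?gt_eqF // TE exprMn sqr_sqrtr //.
    by field.
  by rewrite sqrtr_sqr ger0_norm // divr_ge0 // ltW.
have xT0 : 0 < x / T by rewrite divr_gt0.
have xTT : x / T * T = x by rewrite divfK // gt_eqF.
have w0 : 0 <= w by rewrite mulr_ge0 // ltW.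
have wx : w <= x by rewrite -[leRHS]xTT ler_wpM2l // ltW.
have e1 : nrm2 1 0 0 0 = 1 :> R by rewrite /nrm2; ring.
have nT := nrm2_twist (a T) (b T) (c T) (d T) (s * x).
rewrite n1 ?lexx ?T0' // in nT.
have nt := nrm2_twist (a t) (b t) (c t) (d t) (k * t).
rewrite n1 ?t0 // in nt.
apply: (great_circle nT nt) => //.
- by rewrite aT bT (end_twist s x).1.
- by rewrite w0 wx.
- by rewrite x0 xpi.
- have x0E : twist k a b c d id 1 0 0 0 0 = 1.
    by rewrite /twist a0 b0 mulr0 cos0 sin0; ring.
  have L0 : 0 <= id t - id 0 by rewrite subr0.
  have Lw : Num.sqrt (4^-1 + k ^+ 2) * (id t - id 0) <= pi by rewrite wE subr0
    (le_trans wx) // ltW.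
  have [+ _] := cos_le_twist hc e1 (lexx 0) t0 tT L0 Lw.
  move=> /(_ x0E); rewrite wE subr0 => /le_trans; apply.
  by rewrite /twist !mul1r !mul0r !addr0.
- have xTE : twist k a b c d id (a T * CT - b T * ST) (a T * ST + b T * CT)
     (c T * CT + d T * ST) (d T * CT - c T * ST) T = 1.
    by rewrite -nT /twist kT /nrm2 /CT /ST; ring.
  have L0 : 0 <= id T - id t by rewrite subr_ge0.
  have Lw : Num.sqrt (4^-1 + k ^+ 2) * (id T - id t) <= pi.
    rewrite wE mulrBr xTT; move: w0; rewrite /w; lra.
  have [_ +] := cos_le_twist hc nT t0 tT (lexx T) L0 Lw.
  by move=> /(_ xTE); rewrite wE mulrBr xTT.
Qed.

(** Since sin x is nonzero, [hcurve_great_circle] determines the twisted curve from its end point;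
    both curves carry the same twist, which is then undone. *)
Lemma hcurve_unique T a b c d a2 b2 c2 d2 s x : 0 < T ->
  hcurve T a b c d id -> hcurve T a2 b2 c2 d2 id ->
  a 0 = 1 -> b 0 = 0 -> a2 0 = 1 -> b2 0 = 0 ->
  a T = endA s x -> b T = endB s x -> -1 <= s <= 1 -> 0 < x < pi ->
  T = 2 * x * Num.sqrt (1 - s ^+ 2) ->
  a T = a2 T -> b T = b2 T -> c T = c2 T -> d T = d2 T ->
  forall t, 0 <= t <= T -> [/\ a t = a2 t, b t = b2 t, c t = c2 t & d t = d2 t].
Proof.
move=> T0 hc hc2 a0 b0 a20 b20 aT bT s1 xpi TE ea eb ec ed t ht.
have [e0 e1 e2 e3] := hcurve_great_circle T0 hc a0 b0 aT bT s1 xpi TE ht.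
rewrite ea in aT; rewrite eb in bT.
have [f0 f1 f2 f3] := hcurve_great_circle T0 hc2 a20 b20 aT bT s1 xpi TE ht.
rewrite ea eb ec ed in e0 e1 e2 e3.
have sx : sin x != 0 by rewrite gt_eqF // sin_gt0_pi.
rewrite -f0 in e0; rewrite -f1 in e1; rewrite -f2 in e2; rewrite -f3 in e3.
move/(mulfI sx): e0 => e0; move/(mulfI sx): e1 => e1; move/(mulfI sx): e2 => e2;
  move/(mulfI sx): e3 => e3.
have CS := cos2Dsin2 (s * x / T * t).
move: e0 e1 e2 e3 CS; set C := cos _; set S := sin _ => e0 e1 e2 e3 CS.
split.
- have -> : a t = C * (a t * C - b t * S) + S * (a t * S + b t * C).
    by rewrite -[LHS]mulr1 -CS; ring.
  by rewrite e0 e1 -[RHS]mulr1 -CS; ring.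
- have -> : b t = C * (a t * S + b t * C) - S * (a t * C - b t * S).
    by rewrite -[LHS]mulr1 -CS; ring.
  by rewrite e0 e1 -[RHS]mulr1 -CS; ring.
- have -> : c t = C * (c t * C + d t * S) - S * (d t * C - c t * S).
    by rewrite -[LHS]mulr1 -CS; ring.
  by rewrite e2 e3 -[RHS]mulr1 -CS; ring.
- have -> : d t = S * (c t * C + d t * S) + C * (d t * C - c t * S).
    by rewrite -[LHS]mulr1 -CS; ring.
  by rewrite e2 e3 -[RHS]mulr1 -CS; ring.
Qed.

(** * Coordinates of matrix curves and their translations *)

Definition cA (M : 'M[R]_4) := M ord0 ord0.
Definition cB (M : 'M[R]_4) := M (inord 1) ord0.
Definition cC (M : 'M[R]_4) := M ord0 (inord 2).
Definition cD (M : 'M[R]_4) := M (inord 3) ord0.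

Lemma cA_qm (a b c d : R) : cA (qm a b c d) = a. Proof. by rewrite /cA mxE. Qed.
Lemma cB_qm (a b c d : R) : cB (qm a b c d) = b. Proof. by rewrite /cB mxE inordK. Qed.
Lemma cC_qm (a b c d : R) : cC (qm a b c d) = c. Proof. by rewrite /cC mxE inordK. Qed.
Lemma cD_qm (a b c d : R) : cD (qm a b c d) = d. Proof. by rewrite /cD mxE inordK. Qed.
Definition coord_qm := (cA_qm, cB_qm, cC_qm, cD_qm).

Lemma SU2_coord (g : 'M[R]_4) : SU2 g -> g = qm (cA g) (cB g) (cC g) (cD g) /\
  nrm2 (cA g) (cB g) (cC g) (cD g) = 1.
Proof. by move=> /SU2P[a [b [c [d [n ->]]]]]; rewrite !coord_qm. Qed.

Definition hcurve_mx T (gam : R -> 'M[R]_4) L :=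
  (forall t, 0 <= t <= T -> SU2 (gam t)) /\
  hcurve T (fun t => cA (gam t)) (fun t => cB (gam t)) (fun t => cC (gam t)) (fun t =>
    cD (gam t)) L.

(** One statement for left and right translations: [hcurve] only involves the norm and the vanishing
    of the k-component, so this form may be rescaled by e. Right translation by 2 p2 has e = -1. *)
Lemma hcurve_linear T a b c d L (m00 m01 m02 m03 m10 m11 m12 m13 m20 m21 m22 m23 m30
  m31 m32 m33 e : R) : 0 <= T ->
  hcurve T a b c d L ->
  let n0 (x y z t : R) := m00 * x + m01 * y + m02 * z + m03 * t in
  let n1 (x y z t : R) := m10 * x + m11 * y + m12 * z + m13 * t in
  let n2 (x y z t : R) := m20 * x + m21 * y + m22 * z + m23 * t in
  let n3 (x y z t : R) := m30 * x + m31 * y + m32 * z + m33 * t in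
  (forall x y z t, nrm2 (n0 x y z t) (n1 x y z t) (n2 x y z t) (n3 x y z t) = nrm2 x y
    z t) ->
  (forall x y z t x' y' z' t', n0 x y z t * n1 x' y' z' t' - n1 x y z t * n0 x' y' z' t' +
    n3 x y z t * n2 x' y' z' t' - n2 x y z t * n3 x' y' z' t' =
    e * (x * y' - y * x' + t * z' - z * t')) ->
  hcurve T (fun t => n0 (a t) (b t) (c t) (d t)) (fun t => n1 (a t) (b t) (c t) (d t))
     (fun t => n2 (a t) (b t) (c t) (d t)) (fun t => n3 (a t) (b t) (c t) (d t)) L.
Proof.
move=> T0 [[la lb lc ld lL] n1' hae] n0 n1 n2 n3 Hn Hh.
have lin x y z t : lip T (fun u => x * a u + y * b u + z * c u + t * d u).
  have Z r f : lip T f -> lip T (fun u => r * f u) by move=> hf; exact: (lipM T0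
    (lip_cst T r) hf).
  exact: (lipD (lipD (lipD (Z x _ la) (Z y _ lb)) (Z z _ lc)) (Z t _ ld)).
split.
- by split=> //; exact: lin.
- by move=> t ht; rewrite Hn n1'.
- apply: ae_mono hae => u hu uT.
  have [a' [b' [c' [d' [L' [[da db] dc dd dL [hor L0 sp]]]]]]] := hu uT.
  have D x y z t : is_derive u 1 (fun u => x * a u + y * b u + z * c u + t * d u)
       (x * a' + y * b' + z * c' + t * d').
    exact: (is_derive_add (is_derive_add (is_derive_add (is_derive_scal x da)
      (is_derive_scal y db)) (is_derive_scal z dc)) (is_derive_scal t dd)).
  exists (n0 a' b' c' d'), (n1 a' b' c' d'), (n2 a' b' c' d'), (n3 a' b' c' d'), L'.
  split; [by split; exact: D|exact: D|exact: D|exact: dL|].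
  by split => //; [rewrite Hh hor mulr0|rewrite Hn].
Qed.

Lemma hcurve_ext_in T a b c d a2 b2 c2 d2 L :
  (forall t, 0 <= t <= T -> [/\ a t = a2 t, b t = b2 t, c t = c2 t & d t = d2 t]) ->
  hcurve T a b c d L -> hcurve T a2 b2 c2 d2 L.
Proof.
move=> E [[la lb lc ld lL] n1 hae].
have lE f g : (forall t, 0 <= t <= T -> f t = g t) -> lip T f -> lip T g.
  by move=> fg [K HK]; exists K => s t hs ht; rewrite -!fg //; exact: HK.
split.
- by split=> //; [apply: lE la|apply: lE lb|apply: lE lc|apply: lE ld] => t /E[].
- by move=> t ht; have [<- <- <- <-] := E t ht; exact: n1.
- apply: ae_mono hae => u hu uT.
  have [a' [b' [c' [d' [L' [[da db] dc dd dL [hor L0 sp]]]]]]] := hu uT.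
  have N : \forall v \near u, 0 <= v <= T.
    have : \forall v \near u, v \in `]0, T[ by apply: near_in_itvoo; rewrite in_itv.
    by apply: filterS => v; rewrite in_itv /= => /andP[? ?]; rewrite !ltW.
  have uT' : 0 <= u <= T by case/andP: uT => ? ?; rewrite !ltW.
  have DE f g (l : R) : (forall t, 0 <= t <= T -> f t = g t) -> is_derive u 1 f l ->
    is_derive u 1 g l.
    move=> fg hf; refine (near_eq_is_derive _ hf).
    by apply: filterS N => v; exact: fg.
  exists a', b', c', d', L'.
  split; [split|..] => //.
  + by apply: DE da => t /E[].
  + by apply: DE db => t /E[].
  + by apply: DE dc => t /E[].
  + by apply: DE dd => t /E[].
  + by have [<- <- <- <-] := E u uT'.
Qed.

Lemma hcurve_mx_left T gam L p : 0 <= T -> SU2 p -> hcurve_mx T gam L -> hcurve_mx T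
  (fun t => p *m gam t) L.
Proof.
move=> T0 /SU2P[a [b [c [d [np ->]]]]] [hS hc]; split.
  by move=> t ht; apply: SU2M; [exact: SU2_qm|exact: hS].
have h := @hcurve_linear T _ _ _ _ L a (- b) (- c) (- d) b a (- d) c c d a (- b) d (-
  c) b a 1 T0 hc.
apply: hcurve_ext_in (h _ _).
- move=> t ht /=; have [-> _] := SU2_coord (hS t ht); rewrite qmM !coord_qm.
  by split; ring.
- move=> x y z t; rewrite -[RHS]mul1r -np /nrm2; ring.
- move=> x y z t x' y' z' t'; rewrite -np /nrm2; ring.
Qed.

(** Right translation conjugates the body velocity by q; an element of [Id] fixes or negates the
    k-component, so horizontality survives. *)
Lemma hcurve_mx_right T gam L q : 0 <= T -> id_class q -> hcurve_mx T gam L ->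
  hcurve_mx T (fun t => gam t *m q) L.
Proof.
move=> T0 hq [hS hc]; split.
  by move=> t ht; apply: SU2M; [exact: hS|exact: id_class_SU2].
case: hq => ->.
- apply: hcurve_ext_in hc => t ht; have [-> _] := SU2_coord (hS t ht); rewrite qmM
  !coord_qm.
  by split; ring.
- have h := @hcurve_linear T _ _ _ _ L (-1) 0 0 0 0 (-1) 0 0 0 0 (-1) 0 0 0 0 (-1) 1 T0 hc.
  apply: hcurve_ext_in (h _ _).
  + move=> t ht /=; have [-> _] := SU2_coord (hS t ht); rewrite qmM !coord_qm.
    by split; ring.
  + by move=> x y z t; rewrite /nrm2; ring.
  + by move=> x y z t x' y' z' t'; ring.
- have h := @hcurve_linear T _ _ _ _ L 0 0 0 (-1) 0 0 1 0 0 (-1) 0 0 1 0 0 0 (-1) T0 hc.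
  apply: hcurve_ext_in (h _ _).
  + move=> t ht /=; have [-> _] := SU2_coord (hS t ht); rewrite qmM !coord_qm.
    by split; ring.
  + by move=> x y z t; rewrite /nrm2; ring.
  + by move=> x y z t x' y' z' t'; ring.
- have h := @hcurve_linear T _ _ _ _ L 0 0 0 1 0 0 (-1) 0 0 1 0 0 (-1) 0 0 0 (-1) T0 hc.
  apply: hcurve_ext_in (h _ _).
  + move=> t ht /=; have [-> _] := SU2_coord (hS t ht); rewrite qmM !coord_qm.
    by split; ring.
  + by move=> x y z t; rewrite /nrm2; ring.
  + by move=> x y z t x' y' z' t'; ring.
Qed.

End Geo2.

(** * Length functions *)

Section Meas.
Variable R : realType.
Notation mu := (@lebesgue_measure R).
Implicit Types (f g : R -> R) (T : R).

Lemma ae_and (P Q : R -> Prop) : {ae mu, forall x, P x} -> {ae mu, forall x, Q x} ->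
  {ae mu, forall x, P x /\ Q x}.
Proof.
move=> hP hQ; apply: filterI => //; exact: (ae_filter_ringOfSetsType mu).
Qed.

(** The integral of a nonnegative function is a supremum over simple functions below it, hence
    monotone. This serves for [sr_length], whose integrand is shown measurable only off the
    exceptional null set. *)
Lemma le_integral_nonmeasurable (D : set R) (f g : R -> \bar R) :
  (forall x, D x -> (0 <= f x)%E) -> (forall x, D x -> (f x <= g x)%E) ->
  (\int[mu]_(x in D) f x <= \int[mu]_(x in D) g x)%E.
Proof.
move=> f0 fg.
rewrite ge0_integralE // [leRHS]ge0_integralE; last first.
  by move=> x Dx; apply: le_trans (fg x Dx); exact: f0.
apply: le_ereal_sup => _ [h hf <-]; exists h => // x.
apply: (le_trans (hf x)); rewrite /patch; case: ifPn => // /set_mem; exact: fg.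
Qed.

(** F integrates [h], which is phi replaced by 0 off the good set: bounded and measurable, so F is
    Lipschitz and [FTC1] differentiates it almost everywhere. For lower bounds on lengths the
    inequality with the integral of phi is enough. *)
Lemma primitive_ae T (phi : R -> R) (K : R) (N : set R) : 0 <= T ->
  (forall t, 0 <= phi t) -> measurable N -> mu N = 0%E ->
  measurable_fun (`]0, T[ `\` N) phi -> (forall t, (`]0, T[ `\` N) t -> phi t <= K) ->
  exists F, [/\ lip T F, F 0 = 0, 0 <= F T,
    ((F T)%:E <= \int[mu]_(t in itv0 T) (phi t)%:E)%E &
    {ae mu, forall t, 0 < t < T -> is_derive t 1 F (phi t)}].
Proof.
move=> T0 phi0 mN N0 mphi phiK.
set A := _ `\` N in mphi phiK.
have mA : measurable A by apply: measurableD.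
pose h := phi \_ A.
have mh : measurable_fun setT h by apply/(measurable_restrictT _ mA).
have h0 t : 0 <= h t by rewrite /h /patch; case: ifP.
have hphi t : h t <= phi t by rewrite /h /patch; case: ifP.
have hK t : h t <= `|K|.
  rewrite /h /patch; case: ifPn => [/set_mem At|_]; last exact: normr_ge0.
  by rewrite (le_trans (phiK t At)) // ler_norm.
have hint (D : set R) : measurable D -> (mu D < +oo)%E -> mu.-integrable D (EFin \o h).
  move=> mD Dfin; apply: measurable_bounded_integrable => //.
    exact: measurable_funS mh.
  exists `|K|; split; first exact: num_real.
  by move=> x Kx y Dy /=; rewrite ger0_norm // (le_trans (hK y)) // ltW.
have hitv (y : R) (b : bool) : mu.-integrable [set` Interval (BSide b 0) (BRight y)]
  (EFin \o h).
  apply: hint; first exact: measurable_itv.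
  have := lebesgue_measure_itv (Interval (BSide b 0) (BRight y)) => ->.
  by case: ifP => // _; rewrite -EFinD ltry.
pose F y := (\int[mu]_(t in [set` Interval (BLeft 0) (BRight y)]) (h t))%R.
exists F.
have mitv (s t : R) : s <= t -> mu `]s, t] = (t - s)%:E.
  move=> st.
  have -> : mu `]s, t] = (if s < t then (t%:E - s%:E)%E else 0%E).
    by have := lebesgue_measure_itv `]s, t] => /= ->; rewrite lte_fin.
  by move: st; rewrite le_eqVlt => /orP[/eqP->|->]; rewrite ?ltxx ?subrr.
have FD s t : 0 <= s -> s <= t -> 0 <= F t - F s <= `|K| * (t - s).
  move=> s0 st.
  have fin : (mu `]s, t] < +oo)%E by rewrite (mitv _ _ st) ltry.
  have -> : F t - F s = (\int[mu]_(x in `]s, t]) h x)%R.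
    by apply: Rintegral_itvB; [exact: hitv|rewrite bnd_simp|rewrite bnd_simp].
  rewrite Rintegral_ge0 //=.
  have -> : `|K| * (t - s) = (\int[mu]_(x in `]s, t]) `|K|)%R.
    rewrite Rintegral_cst //; congr (_ * _).
    exact: (esym (congr1 fine (mitv s t st))).
  apply: le_Rintegral => //.
  - exact: hint.
  - apply: measurable_bounded_integrable => //.
    exists `|K|; split; first exact: num_real.
    by move=> x Kx y Dy /=; rewrite normr_id ltW.
split.
- exists `|K| => s t /andP[s0 sT] /andP[t0 tT].
  have [st|/ltW ts] := leP s t.
    have /andP[h1 h2] := FD s t s0 st.
    by rewrite distrC (ger0_norm h1) [`|s - t|]distrC [`|t - s|]ger0_norm // subr_ge0.
  have /andP[h1 h2] := FD t s t0 ts.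
  by rewrite (ger0_norm h1) [`|s - t|]ger0_norm // subr_ge0.
- by rewrite /F set_itv1 Rintegral_set1.
- exact: Rintegral_ge0.
- rewrite /F /Rintegral fineK; last first.
    by apply: integrable_fin_num => //; exact: hitv.
  by apply: le_integral_nonmeasurable => t _; rewrite lee_fin.
- have hN : {ae mu, forall t, ~ N t} by exists N; split => // t /= /contrapT.
  have locf : locally_integrable [set: R] h.
    split => //; first exact: openT.
    move=> C _ cC.
    have mC : measurable C by exact: compact_measurable.
    have /integrableP[_] : mu.-integrable C (EFin \o h).
      by apply: hint => //; exact: compact_finite_measure.
    by [].
  have := ae_and hN (FTC1 (fun y => hitv y true) locf).
  apply: ae_mono => t [nN Ft] /andP[t0 tT].
  have [dF F'] := Ft ltac:(by rewrite lte_fin).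
  have <- : h t = phi t.
    by rewrite /h /patch mem_set //; split => //=; rewrite in_itv /= t0.
  by refine (DeriveDef dF _); rewrite -derive1E F'.
Qed.

End Meas.

(** * From horizontal curves to their length functions *)

Section Mat.
Variable R : realType.
Notation mu := (@lebesgue_measure R).
Implicit Types (f g : R -> R) (T : R) (gam : R -> 'M[R]_4).

Lemma is_derive_qm (a b c d : R -> R) (t a' b' c' d' : R) :
  is_derive t 1 a a' -> is_derive t 1 b b' -> is_derive t 1 c c' -> is_derive t 1 d d' ->
  is_derive t 1 (fun t => qm (a t) (b t) (c t) (d t)) (qm a' b' c' d').
Proof.
move=> da db dc dd.
have E (i j : 'I_4) : is_derive t 1 (fun t => qm (a t) (b t) (c t) (d t) i j) (qm a' b'
  c' d' i j).
  have na := is_derive_opp da; have nb := is_derive_opp db.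
  have nc := is_derive_opp dc; have nd := is_derive_opp dd.
  have mE : (fun t => qm (a t) (b t) (c t) (d t) i j) =
    (fun t => nth 0 (nth [::] [:: [:: a t; - b t; c t; - d t]; [:: b t; a t; d t; c t];
                        [:: - c t; - d t; a t; b t]; [:: d t; - c t; - b t; a t]] i) j).
    by apply/funext => u; rewrite mxE.
  rewrite {}mE mxE; move: i j => [[|[|[|[|//]]]] ?] [[|[|[|[|//]]]] ?] /=;
    first [exact: da|exact: db|exact: dc|exact: dd|exact: na|exact: nb|exact: nc|exact: nd].
have D : derivable (fun t => qm (a t) (b t) (c t) (d t)) t 1.
  by apply/derivable_mxP => i j; exact: (@ex_derive _ _ _ _ _ _ _ (E i j)).
refine (DeriveDef D _); rewrite (derive_mx D); apply/matrixP => i j; rewrite mxE.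
exact: (@derive_val _ _ _ _ _ _ _ (E i j)).
Qed.

Lemma mx_entry_le (M : 'M[R]_4) i j : `|M i j| <= `|M|.
Proof.
rewrite [leRHS]/Num.Def.normr /= mx_normrE.
exact: (le_bigmax _ (fun ij : 'I_4 * 'I_4 => `|M ij.1 ij.2|) (i, j)).
Qed.

Lemma qm_norm_le (a b c d : R) : `|qm a b c d| <= `|a| + `|b| + `|c| + `|d|.
Proof.
have [ha hb hc hd] : [/\ `|a| <= `|a| + `|b| + `|c| + `|d|, `|b| <= `|a| + `|b| + `|c|
  + `|d|,
   `|c| <= `|a| + `|b| + `|c| + `|d| & `|d| <= `|a| + `|b| + `|c| + `|d|].
  by have := normr_ge0 a; have := normr_ge0 b; have := normr_ge0 c; have := normr_ge0 d;
     split; lra.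
rewrite [leLHS]/Num.Def.normr /= mx_normrE (bigmax_le) ?addr_ge0 // => -[i j] _ /=.
rewrite mxE; move: i j => [[|[|[|[|//]]]] ?] [[|[|[|[|//]]]] ?] /=; rewrite ?normrN //.
Qed.

Lemma lip_coord T gam (phi : 'M[R]_4 -> R) : (exists i j, forall M, phi M = M i j) ->
  (exists L : R, forall s t, 0 <= s <= T -> 0 <= t <= T -> `|gam s - gam t| <= L * `|s
    - t|) ->
  lip T (fun t => phi (gam t)).
Proof.
move=> [i [j E]] [L HL]; exists L => s t hs ht; apply: le_trans (HL _ _ hs ht).
by rewrite !E; have := mx_entry_le (gam s - gam t) i j; rewrite !mxE.
Qed.

Lemma pip_qm (a b c d a' b' c' d' : R) :
  pip (qm a b c d) (qm a' b' c' d') = - (4 * (a * a' - b * b' - c * c' - d * d')).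
Proof. by rewrite /pip qmM trqm. Qed.

Lemma in_p_qm (a b c d : R) : in_p (qm a b c d) <-> a = 0 /\ b = 0.
Proof.
split=> [[u1 [u2]]|[-> ->]].
  by rewrite p1E p2E !qmZ qmD => /qm_inj[-> -> _ _]; split; ring.
exists (2 * c), (2 * d); rewrite p1E p2E !qmZ qmD; congr qm; lra.
Qed.

Lemma bodyvel_qm gam t a b c d a' b' c' d' :
  nrm2 a b c d = 1 -> gam t = qm a b c d -> is_derive t 1 gam (qm a' b' c' d') ->
  bodyvel gam t = qm (a * a' + b * b' + c * c' + d * d') (a * b' - b * a' + d * c' - c * d')
    (a * c' - c * a' + b * d' - d * b') (a * d' - d * a' + c * b' - b * c').
Proof.
move=> n gE D; rewrite /bodyvel gE (qm_inv n) (@derive_val _ _ _ _ _ _ _ D) qmM.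
congr qm; ring.
Qed.

Lemma curve_derive T gam t : (forall t, 0 <= t <= T -> SU2 (gam t)) -> 0 < t < T ->
  derivable gam t 1 ->
  let a := fun t => cA (gam t) in let b := fun t => cB (gam t) in
  let c := fun t => cC (gam t) in let d := fun t => cD (gam t) in
  [/\ [/\ derivable a t 1, derivable b t 1, derivable c t 1 & derivable d t 1],
    in_p (bodyvel gam t) -> a t * 'D_1 b t - b t * 'D_1 a t + d t * 'D_1 c t - c t *
      'D_1 d t = 0 &
    in_p (bodyvel gam t) -> pip (bodyvel gam t) (bodyvel gam t) =
      4 * nrm2 ('D_1 a t) ('D_1 b t) ('D_1 c t) ('D_1 d t)].
Proof.
move=> hS tT dg a b c d; have dg' := (derivable_mxP gam t 1).1 dg.
have dd : [/\ derivable a t 1, derivable b t 1, derivable c t 1 & derivable d t 1].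
  by split; exact: dg'.
have [da db dc de] := dd.
have N : \forall v \near t, 0 <= v <= T.
  have : \forall v \near t, v \in `]0, T[ by apply: near_in_itvoo; rewrite in_itv.
  by apply: filterS => v; rewrite in_itv /= => /andP[? ?]; rewrite !ltW.
have tT' : 0 <= t <= T by case/andP: tT => ? ?; rewrite !ltW.
have D : is_derive t 1 gam (qm ('D_1 a t) ('D_1 b t) ('D_1 c t) ('D_1 d t)).
  have D := is_derive_qm (derivableP da) (derivableP db) (derivableP dc) (derivableP de).
  refine (near_eq_is_derive _ D); apply: filterS N => v hv.
  by have [e _] := SU2_coord (hS v hv); exact: esym.
have [gE n] := SU2_coord (hS t tT').
have bE := bodyvel_qm n gE D.
split => //; rewrite bE => /in_p_qm[e0 e1] //.
rewrite pip_qm.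
(* The norm is multiplicative, so the body velocity has squared norm nrm2 (g) nrm2 (g'). [pip]
   counts its real part with the opposite sign, hence the correction, which [e0] kills. *)
transitivity (4 * (nrm2 (cA (gam t)) (cB (gam t)) (cC (gam t)) (cD (gam t)) *
    nrm2 ('D_1 a t) ('D_1 b t) ('D_1 c t) ('D_1 d t)) - 8 * (cA (gam t) * 'D_1 a t +
    cB (gam t) * 'D_1 b t + cC (gam t) * 'D_1 c t + cD (gam t) * 'D_1 d t) ^+ 2).
  by rewrite /nrm2; ring.
by rewrite e0 n; ring.
Qed.

Lemma derive_lip_le T f : lip T f ->
  exists2 K : R, 0 < K & forall t, 0 < t < T -> derivable f t 1 -> `|'D_1 f t| <= K.
Proof.
move=> /lip_pos[K K0 HK]; exists K => // t /andP[t0 tT] df.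
have := df => /cvg_norm; rewrite /derive => df'.
have -> : `|lim (h^-1 *: (f (h *: 1 + t) - f t) @[h --> 0^'])| =
   lim (`|h^-1 *: (f (h *: 1 + t) - f t)| @[h --> 0^']) by apply/esym/cvg_lim.
apply: limr_le; first by apply/cvg_ex; eexists; exact: df'.
near=> h.
have h0 : h != 0 by near: h; exact: nbhs_dnbhs_neq.
rewrite [_ *: 1]mulr1 normrZ normfV ler_pdivrMl ?normr_gt0 // mulrC.
have hs : `|h| < Num.min t (T - t).
  near: h; apply: dnbhs0_lt; by rewrite lt_min t0 subr_gt0.
move: hs; rewrite lt_min !ltr_norml => /andP[/andP[h1 h2] /andP[h3 h4]].
have := HK (h + t) t ltac:(apply/andP; split; lra) ltac:(apply/andP; split; lra).
by rewrite addrK.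
Unshelve. all: by end_near. Qed.

(** Composing with it extends a function on [0, T] to the whole line, as difference quotients and
    the intermediate value theorem demand. *)
Definition clamp T t := Num.max 0 (Num.min T t).

Lemma lip_clamp_continuous T f : 0 <= T -> lip T f -> continuous (fun t => f (clamp T t)).
Proof.
move=> T0 hf.
have clT t : 0 <= clamp T t <= T by rewrite /clamp le_max lexx /= ge_max T0 ge_min lexx.
have ccl : continuous (clamp T).
  move=> t; apply: continuous_max; first exact: cvg_cst.
  by apply: continuous_min; [exact: cvg_cst|exact: cvg_id].
have [K K0 HK] := lip_pos hf.
move=> t; apply/cvgrPdist_lt => e e0.
have /cvgrPdist_lt /(_ (e / K)) := ccl t; rewrite divr_gt0 // => /(_ isT).
apply: filterS => s hs; apply: le_lt_trans (HK _ _ (clT t) (clT s)) _.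
by rewrite mulrC -ltr_pdivlMr.
Qed.

(** The derivative is the pointwise limit of the continuous difference quotients with step 1 / (n +
    1); these may leave [0, T], whence [clamp]. *)
Lemma measurable_derive_lip T f (A : set R) : 0 <= T -> lip T f -> measurable A ->
  (forall t, A t -> 0 < t < T /\ derivable f t 1) -> measurable_fun A (fun t => 'D_1 f t).
Proof.
move=> T0 hf mA HA.
have clE t : 0 <= t <= T -> clamp T t = t.
  by move=> /andP[t0 tT]; rewrite /clamp min_r // max_r.
pose g t := f (clamp T t); have cg : continuous g by exact: lip_clamp_continuous.
apply: (@measurable_fun_cvg _ _ R A (fun n t => n.+1%:R * (g (n.+1%:R^-1 + t) - g t))
  (fun t => 'D_1 f t)).
  move=> n; apply: measurable_funTS; apply: continuous_measurable_fun => t.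
  apply: cvgM; first exact: cvg_cst.
  apply: cvgB; last exact: cg.
  apply: (@cvg_comp _ _ _ (fun t => n.+1%:R^-1 + t) g _ _ _ _ (cg _)).
  by apply: cvgD; [exact: cvg_cst|exact: cvg_id].
move=> t /HA[tT df].
have N : \forall v \near t, f v = g v.
  have : \forall v \near t, v \in `]0, T[ by apply: near_in_itvoo; rewrite in_itv.
  by apply: filterS => v; rewrite in_itv /= => /andP[? ?]; rewrite /g clE // !ltW.
have := near_eq_is_derive N (derivableP df).
move=> [dg Dg]; rewrite -Dg.
have := dg => /cvgrPdist_lt H.
apply/cvgrPdist_lt => e e0; have [d /= d0 Hd] := H e e0.
near=> n.
have n0 : n.+1%:R^-1 != 0 :> R by rewrite invr_eq0 pnatr_eq0.
have := Hd n.+1%:R^-1; rewrite /ball /= sub0r normrN ger0_norm ?invr_ge0 // => /(_ _ n0).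
rewrite invrK [_ *: 1]mulr1; apply.
near: n; exact: (near_infty_natSinv_lt (PosNum d0)).
Unshelve. all: by end_near. Qed.

Lemma horizontal_length T gam : horizontal T gam -> exists L,
  [/\ hcurve_mx T gam L, L 0 = 0, 0 <= L T, ((L T)%:E <= sr_length T gam)%E &
   {ae mu, forall t, 0 < t < T -> is_derive t 1 L (Num.sqrt (pip (bodyvel gam t)
     (bodyvel gam t)))}].
Proof.
move=> [T0 [hS [hL hae]]].
have [N [mN N0 HN]] := hae.
have la : lip T (fun t => cA (gam t)) by refine (lip_coord _ hL); exists ord0, ord0.
have lb : lip T (fun t => cB (gam t)) by refine (lip_coord _ hL); exists (inord 1), ord0.
have lc : lip T (fun t => cC (gam t)) by refine (lip_coord _ hL); exists ord0, (inord 2).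
have ld : lip T (fun t => cD (gam t)) by refine (lip_coord _ hL); exists (inord 3), ord0.
set a := fun t => cA (gam t) in la; set b := fun t => cB (gam t) in lb.
set c := fun t => cC (gam t) in lc; set d := fun t => cD (gam t) in ld.
pose phi t := Num.sqrt (pip (bodyvel gam t) (bodyvel gam t)).
set A := `]0, T[ `\` N.
have mA : measurable A by apply: measurableD.
have AP t : A t -> [/\ 0 < t < T, derivable gam t 1 & in_p (bodyvel gam t)].
  move=> [/=]; rewrite in_itv /= => tT nN.
  have [] : derivable gam t 1 /\ in_p (bodyvel gam t).
    apply: contrapT => h; apply: nN; apply: HN => /= h'; apply: h; apply: h'.
    by case/andP: tT => ? ?; rewrite !ltW.
  by split.
have dA t : A t -> [/\ derivable a t 1, derivable b t 1, derivable c t 1 & derivable d t 1].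
  by move=> /AP[tT dg _]; have [] := curve_derive hS tT dg.
have phiE t : A t -> phi t = 2 * Num.sqrt (nrm2 ('D_1 a t) ('D_1 b t) ('D_1 c t) ('D_1
  d t)).
  move=> /AP[tT dg bp]; have [_ _ /(_ bp)] := curve_derive hS tT dg.
  rewrite /phi => ->; rewrite sqrtrM //; congr (_ * _).
  have -> : 4 = 2 ^+ 2 :> R by rewrite -natrX.
  by rewrite sqrtr_sqr ger0_norm.
have At t : A t -> 0 < t < T by move=> /AP[].
have ma : measurable_fun A (fun t => 'D_1 a t).
  by apply: (measurable_derive_lip T0 la mA) => t hA; split; [exact: At|have [] := dA t hA].
have mb : measurable_fun A (fun t => 'D_1 b t).
  by apply: (measurable_derive_lip T0 lb mA) => t hA; split; [exact: At|have [] := dA t hA].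
have mc : measurable_fun A (fun t => 'D_1 c t).
  by apply: (measurable_derive_lip T0 lc mA) => t hA; split; [exact: At|have [] := dA t hA].
have md : measurable_fun A (fun t => 'D_1 d t).
  by apply: (measurable_derive_lip T0 ld mA) => t hA; split; [exact: At|have [] := dA t hA].
have mphi : measurable_fun A phi.
  apply: (eq_measurable_fun (fun t => 2 * Num.sqrt (nrm2 ('D_1 a t) ('D_1 b t) ('D_1 c
    t) ('D_1 d t)))).
    by move=> t /set_mem tA; rewrite phiE.
  apply: measurable_funM; first exact: measurable_cst.
  apply: (@measurableT_comp _ _ _ _ _ _ (@Num.sqrt R)).
    by apply: continuous_measurable_fun; exact: sqrt_continuous.
  by rewrite /nrm2; apply: measurable_funD; [apply: measurable_funD; [apply:
    measurable_funD|]|]; apply: measurable_funX.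
have [Ka [Kb [Kc [Kd HK]]]] : exists Ka Kb Kc Kd : R, forall t, A t ->
    [/\ `|'D_1 a t| <= Ka, `|'D_1 b t| <= Kb, `|'D_1 c t| <= Kc & `|'D_1 d t| <= Kd].
  have [Ka _ Ha] := derive_lip_le la; have [Kb _ Hb] := derive_lip_le lb.
  have [Kc _ Hc] := derive_lip_le lc; have [Kd _ Hd] := derive_lip_le ld.
  exists Ka, Kb, Kc, Kd => t hA; have [? ? ? ?] := dA t hA.
  by split; [apply: Ha|apply: Hb|apply: Hc|apply: Hd] => //; exact: At.
have phiK t : A t -> phi t <= 2 * Num.sqrt (nrm2 Ka Kb Kc Kd).
  move=> hA; rewrite phiE // ler_pM2l // ler_wsqrtr // /nrm2.
  have [ha hb hc hd] := HK t hA.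
  have sq (x y : R) : `|x| <= y -> x ^+ 2 <= y ^+ 2.
    by move=> xy; rewrite -(real_normK (num_real x)) ler_pXn2r ?nnegrE // (le_trans _ xy).
  by have := sq _ _ ha; have := sq _ _ hb; have := sq _ _ hc; have := sq _ _ hd; lra.
have [L [lL L0 LT Lint Lae]] := primitive_ae T0 (fun t => sqrtr_ge0 _) mN N0 mphi phiK.
exists L; split => //.
split=> //; split=> //; first by move=> t /hS /SU2_coord[].
apply: ae_mono (ae_and hae Lae) => t [ht hL'] tT.
have tT' : 0 <= t <= T by case/andP: tT => ? ?; rewrite !ltW.
have [dg bp] := ht tT'.
have [[da db dc de] /(_ bp) hor /(_ bp) sp] := curve_derive hS tT dg.
exists ('D_1 a t), ('D_1 b t), ('D_1 c t), ('D_1 d t), (phi t).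
split; [split; [exact: (derivableP da)|exact: (derivableP db)]|exact: (derivableP
  dc)|exact: (derivableP de)|exact: (hL' tT)|].
split => //; first exact: sqrtr_ge0.
by rewrite /phi sp sqr_sqrtr // mulr_ge0 // !addr_ge0 // sqr_ge0.
Qed.

(** The length function has derivative 1 almost everywhere, so [t - L t] does not increase by
    [lipschitz_ae_noninc], whence T <= L T. *)
Lemma arclength_hcurve_mx T gam : horizontal T gam ->
  {ae mu, forall t, 0 <= t <= T -> pip (bodyvel gam t) (bodyvel gam t) = 1} ->
  hcurve_mx T gam id /\ (T%:E <= sr_length T gam)%E.
Proof.
move=> hor h1; have [L [[hS hc] L0 LT Llen Lae]] := horizontal_length hor.
have T0 := hor.1.
have h : {ae mu, forall t, 0 < t < T -> is_derive t 1 L 1}.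
  apply: ae_mono (ae_and h1 Lae) => t [p1 hL] tT.
  have := hL tT; rewrite p1 ?sqrtr1 //.
  by case/andP: tT => ? ?; rewrite !ltW.
have [[la lb lc ld lL] n1 hae] := hc.
split; last first.
  apply: le_trans Llen; rewrite lee_fin.
  have : lip T (fun t => t - L t) by apply: lipB => //; exact: lip_id.
  move=> /lip_pos[K K0 HK].
  have := @lipschitz_ae_noninc R (fun t => t - L t) K 0 T T0 _ _.
  rewrite L0 subr0 subr_le0; apply.
    move=> u v su uv vt; rewrite -(ger0_norm (_ : 0 <= v - u)) ?subr_ge0 //.
    apply: (le_trans (ler_norm _)); apply: HK.
      by apply/andP; split; lra.
    by apply/andP; split; lra.
  apply: ae_mono h => t ht /ht dL.
  have D := is_derive_sub (is_derive_id t 1) dL.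
  split; first exact: (@ex_derive _ _ _ _ _ _ _ D).
  by rewrite (@derive_val _ _ _ _ _ _ _ D) subrr.
split => //; split => //; first by split => //; exact: lip_id.
apply: ae_mono (ae_and hae h) => t [ht hL] tT.
have [a' [b' [c' [d' [L' [[da db] dc dd dL [hr L0' sp]]]]]]] := ht tT.
have e : L' = 1 by rewrite -(@derive_val _ _ _ _ _ _ _ dL) (@derive_val _ _ _ _ _ _ _
  (hL tT)).
exists a', b', c', d', 1; split => //; first exact: is_derive_id.
by rewrite e in sp; split.
Qed.

(** L only has to dominate the speed, so a constant curve may carry a growing L; this handles
    [T = 0] in [length_ge]. *)
Lemma hcurve_cst T (e : R) : 0 <= e -> hcurve T (fun=> 1) (fun=> 0) (fun=> 0) (fun=> 0)
  (fun t => e * t).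
Proof.
move=> e0; split.
- split; try exact: lip_cst.
  exists e => s t _ _; by rewrite -mulrBr normrM ger0_norm.
- by move=> t _; rewrite /nrm2; ring.
- apply: aeW => t _; exists 0, 0, 0, 0, e; split; [split|..]; try exact:
  (@is_derive_cst R R R).
    have := is_derive_scal e (is_derive_id t 1); by rewrite mulr1.
  by split; [ring|done|rewrite /nrm2 expr0n /= !addr0 mulr0 sqr_ge0].
Qed.

Definition reach_mx (h : 'M[R]_4) (l : R) := reach (cA h) (cB h) l.

Lemma length_ge T gam l : horizontal T gam -> reach_mx (invmx (gam 0) *m gam T) l ->
  (l%:E <= sr_length T gam)%E.
Proof.
move=> hor hr; have [L [hc L0 LT Llen _]] := horizontal_length hor.
have T0 := hor.1; apply: le_trans Llen; rewrite lee_fin.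
have g0S : SU2 (gam 0) by apply: hc.1; rewrite lexx.
have g01 : invmx (gam 0) *m gam 0 = qm 1 0 0 0 by rewrite mulVmx ?qm1 // SU2_unit.
(* [hcurve_lower] asks for [0 < L T], so L is given a slack e, spread linearly over [0, T]. *)
apply/ler_addgt0Pr => e e0.
move: T0; rewrite le_eqVlt => /orP[/eqP T0|T0].
  have h := hcurve_cst 1 (ltW e0).
  have := @hcurve_lower R 1 _ _ _ _ _ l ler01 h erefl erefl; rewrite mulr0 mulr1 => /(_
    erefl e0).
  rewrite -T0 L0 add0r; apply; move: hr; rewrite /reach_mx -T0 g01 !coord_qm //.
have [_ hc'] := hcurve_mx_left (ltW T0) (SU2V g0S) hc.
pose M t := L t + e / T * t.
have hM : hcurve T (fun t => cA (invmx (gam 0) *m gam t)) (fun t => cB (invmx (gam 0)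
  *m gam t))
   (fun t => cC (invmx (gam 0) *m gam t)) (fun t => cD (invmx (gam 0) *m gam t)) M.
  have [[la lb lc ld lL] n1 hae] := hc'.
  have eT : 0 <= e / T by rewrite divr_ge0 // ltW.
  split => //.
    split => //; apply: lipD => //; apply: lipM; [exact: ltW|exact: lip_cst|exact: lip_id].
  apply: ae_mono hae => t ht tT.
  have [a' [b' [c' [d' [L' [[da db] dc dd dL [hr' L0' sp]]]]]]] := ht tT.
  exists a', b', c', d', (L' + e / T); split => //.
    have := is_derive_add dL (is_derive_scal (e / T) (is_derive_id t 1)); by rewrite mulr1.
  split => //; first by rewrite addr_ge0.
  by apply: (le_trans sp); rewrite ler_pXn2r ?nnegrE ?addr_ge0 // lerDl.
have ME : M T = L T + e by rewrite /M divfK // gt_eqF.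
rewrite -ME; apply: (hcurve_lower (ltW T0) hM) => //.
- by rewrite g01 coord_qm.
- by rewrite g01 coord_qm.
- by rewrite /M L0 mulr0 addr0.
- by rewrite ME ltr_wpDl.
Qed.

End Mat.

(** * Explicit geodesics and distances *)

Section Fin.
Variable R : realType.
Notation mu := (@lebesgue_measure R).
Implicit Types (f : R -> R) (T : R) (gam : R -> 'M[R]_4) (g h p q : 'M[R]_4).

(** For curves given by formulas: p cancels in the body velocity, so the computation is that for p =
    1. *)
Lemma arclength_curve T p (a b c d a' b' c' d' : R -> R) : 0 <= T -> SU2 p ->
  (forall t : R, [/\ is_derive t 1 a (a' t), is_derive t 1 b (b' t), is_derive t 1 c
    (c' t) & is_derive t 1 d (d' t)]) ->
  [/\ lip T a, lip T b, lip T c & lip T d] ->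
  (forall t, nrm2 (a t) (b t) (c t) (d t) = 1) ->
  (forall t, a t * b' t - b t * a' t + d t * c' t - c t * d' t = 0) ->
  (forall t, 4 * nrm2 (a' t) (b' t) (c' t) (d' t) = 1) ->
  let gam := fun t => p *m qm (a t) (b t) (c t) (d t) in
  [/\ horizontal T gam, forall t, pip (bodyvel gam t) (bodyvel gam t) = 1 & sr_length T
    gam = T%:E].
Proof.
move=> T0 pS D [la lb lc ld] n1 hor sp gam.
have [p0 [p1 [p2 [p3 [_ pE]]]]] := (SU2P p).1 pS.
have Dg (t : R) : is_derive t 1 gam (p *m qm (a' t) (b' t) (c' t) (d' t)).
  have [da db dc dd] := D t.
  have lin (x y z w : R) : is_derive t 1 (fun u => x * a u + y * b u + z * c u + w * d u)
     (x * a' t + y * b' t + z * c' t + w * d' t).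
    exact: (is_derive_add (is_derive_add (is_derive_add (is_derive_scal x da)
      (is_derive_scal y db)) (is_derive_scal z dc)) (is_derive_scal w dd)).
  have := is_derive_qm (lin p0 (- p1) (- p2) (- p3)) (lin p1 p0 (- p3) p2)
    (lin p2 p3 p0 (- p1)) (lin p3 (- p2) p1 p0).
  have -> : (fun u => qm (p0 * a u + - p1 * b u + - p2 * c u + - p3 * d u)
    (p1 * a u + p0 * b u + - p3 * c u + p2 * d u) (p2 * a u + p3 * b u + p0 * c u + -
      p1 * d u)
    (p3 * a u + - p2 * b u + p1 * c u + p0 * d u)) = gam.
    by apply/funext => u; rewrite /gam pE qmM; congr qm; ring.
  by rewrite pE qmM; congr (is_derive _ _ _ _); congr qm; ring.
have gg t : a t * a' t + b t * b' t + c t * c' t + d t * d' t = 0.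
  have [da db dc dd] := D t.
  have N : \forall s \near t, nrm2 (a s) (b s) (c s) (d s) = 1 by apply: filterE.
  exact: (is_derive_nrm2 da db dc dd N).
pose gam1 t := qm (a t) (b t) (c t) (d t).
have B t : bodyvel gam t = qm 0 0 (a t * c' t - c t * a' t + b t * d' t - d t * b' t)
   (a t * d' t - d t * a' t + c t * b' t - b t * c' t).
  have [da db dc dd] := D t.
  have Dq : is_derive t 1 gam1 (qm (a' t) (b' t) (c' t) (d' t)) := is_derive_qm da db dc dd.
  have := @bodyvel_qm R gam1 t _ _ _ _ _ _ _ _ (n1 t) erefl Dq; rewrite gg hor => <-.
  rewrite /bodyvel (@derive_val _ _ _ _ _ _ _ (Dg t)) (@derive_val _ _ _ _ _ _ _ Dq).
  have qS : SU2 (gam1 t) by exact: SU2_qm.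
  have gu : gam t \in unitmx by apply: SU2_unit; exact: SU2M.
  rewrite -[in LHS](mulKVmx (SU2_unit qS) (qm (a' t) _ _ _)).
  by rewrite [p *m (_ *m _)]mulmxA (mulKmx gu).
have P t : pip (bodyvel gam t) (bodyvel gam t) = 1.
  rewrite B pip_qm.
  transitivity (4 * (nrm2 (a t) (b t) (c t) (d t) * nrm2 (a' t) (b' t) (c' t) (d' t)
     - (a t * a' t + b t * b' t + c t * c' t + d t * d' t) ^+ 2
     - (a t * b' t - b t * a' t + d t * c' t - c t * d' t) ^+ 2)).
    by rewrite /nrm2; ring.
  by rewrite n1 gg hor mul1r expr0n /= !subr0 sp.
split => //; last first.
  rewrite /sr_length; under eq_integral do rewrite P sqrtr1.
  have := @integral_cst _ _ R mu (itv0 T) (measurable_itv _) 1%E.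
  rewrite mul1e => ->.
  have := lebesgue_measure_itv `[0, T] => /= ->; rewrite lte_fin.
  by move: T0; rewrite le_eqVlt => /orP[/eqP<-|->]; rewrite ?ltxx ?sube0.
split => //; split.
  by move=> t _; apply: SU2M => //; exact: SU2_qm.
split.
  have lin (x y z w : R) : lip T (fun u => x * a u + y * b u + z * c u + w * d u).
    have Z r f : lip T f -> lip T (fun u => r * f u) by move=> hf; exact: (lipM T0
      (lip_cst T r) hf).
    exact: (lipD (lipD (lipD (Z x _ la) (Z y _ lb)) (Z z _ lc)) (Z w _ ld)).
  have [K0 H0] := lin p0 (- p1) (- p2) (- p3); have [K1 H1] := lin p1 p0 (- p3) p2.
  have [K2 H2] := lin p2 p3 p0 (- p1); have [K3 H3] := lin p3 (- p2) p1 p0.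
  exists (K0 + K1 + K2 + K3) => s t hs ht.
  have := H0 s t hs ht; have := H1 s t hs ht; have := H2 s t hs ht; have := H3 s t hs ht.
  rewrite !mulrDl => h3 h2 h1 h0.
  apply: le_trans (lerD (lerD (lerD h0 h1) h2) h3); apply: le_trans (qm_norm_le _ _ _ _).
  rewrite /gam pE !qmM qmN qmD; rewrite le_eqVlt; apply/orP; left; apply/eqP; congr (`|
    _ |); congr qm; ring.
apply: aeW => t _; split; first exact: (@ex_derive _ _ _ _ _ _ _ (Dg t)).
by rewrite B; apply/in_p_qm.
Qed.

(** The curve e^{t (P + c k)} e^{-t c k} in the parameter s of [endA], with P = cos sg p1 + sin sg
    p2; y is half of t / sqrt (1 - s^2), as t is arclength. *)
Definition geo (s sg t : R) : 'M[R]_4 :=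
  let v := Num.sqrt (1 - s ^+ 2) in let y := (2 * v)^-1 * t in
  qm (endA s y) (endB s y) (v * sin y * cos (sg + s * y)) (v * sin y * sin (sg + s * y)).

Lemma geo_arclength T p s sg : 0 <= T -> SU2 p -> -1 < s < 1 ->
  let gam := fun t => p *m geo s sg t in
  [/\ horizontal T gam, forall t, pip (bodyvel gam t) (bodyvel gam t) = 1 & sr_length T
    gam = T%:E].
Proof.
move=> T0 pS /andP[s1 s2].
have s3 : 0 < 1 - s ^+ 2.
  have : s ^+ 2 < 1 by rewrite -(real_normK (num_real s)) expr_lt1 // ltr_norml s1 s2.
  by rewrite subr_gt0.
rewrite /geo; set v := Num.sqrt _; set r := (2 * v)^-1.
have v2 : v ^+ 2 = 1 - s ^+ 2 by rewrite sqr_sqrtr // ltW.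
have v0 : 0 < v by rewrite sqrtr_gt0.
have r2 : 4 * (r ^+ 2 * v ^+ 2) = 1 by rewrite /r; field; rewrite gt_eqF.
have Dy (t : R) : is_derive t 1 (fun t => r * t) r.
  by have := is_derive_scal r (is_derive_id t 1); rewrite mulr1.
have Dcy (t : R) : is_derive t 1 (fun t => cos (r * t)) (- sin (r * t) * r).
  exact: (@is_derive1_comp _ cos (fun t => r * t) _ _ _ (is_derive_cos _) (Dy t)).
have Dsy (t : R) : is_derive t 1 (fun t => sin (r * t)) (cos (r * t) * r).
  exact: (@is_derive1_comp _ sin (fun t => r * t) _ _ _ (is_derive_sin _) (Dy t)).
have Dsv t := is_derive_scal s (Dy t).
have Dcs (t : R) : is_derive t 1 (fun t => cos (s * (r * t))) (- sin (s * (r * t)) * (s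
  * r)).
  exact: (@is_derive1_comp _ cos (fun t => s * (r * t)) _ _ _ (is_derive_cos _) (Dsv t)).
have Dss (t : R) : is_derive t 1 (fun t => sin (s * (r * t))) (cos (s * (r * t)) * (s * r)).
  exact: (@is_derive1_comp _ sin (fun t => s * (r * t)) _ _ _ (is_derive_sin _) (Dsv t)).
have Dz (t : R) : is_derive t 1 (fun t => sg + s * (r * t)) (s * r).
  by have := is_derive_add (is_derive_cst sg t 1) (Dsv t); rewrite add0r.
have Dcz (t : R) : is_derive t 1 (fun t => cos (sg + s * (r * t))) (- sin (sg + s * (r
  * t)) * (s * r)).
  exact: (@is_derive1_comp _ cos (fun t => sg + s * (r * t)) _ _ _ (is_derive_cos _)
    (Dz t)).
have Dsz (t : R) : is_derive t 1 (fun t => sin (sg + s * (r * t))) (cos (sg + s * (r *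
  t)) * (s * r)).
  exact: (@is_derive1_comp _ sin (fun t => sg + s * (r * t)) _ _ _ (is_derive_sin _)
    (Dz t)).
have ly : lip T (fun t => r * t) by apply: (lipM T0); [exact: lip_cst|exact: lip_id].
have lsy : lip T (fun t => s * (r * t)) by apply: (lipM T0); [exact: lip_cst|exact: ly].
have lz : lip T (fun t => sg + s * (r * t)) by apply: lipD; [exact: lip_cst|exact: lsy].
have Z x f : lip T f -> lip T (fun t => x * f t) by move=> hf; exact: (lipM T0 (lip_cst
  T x) hf).
pose a' t := - (v ^+ 2 * r * sin (r * t) * cos (s * (r * t))).
pose b' t := v ^+ 2 * r * sin (r * t) * sin (s * (r * t)).
pose c' t := v * r * (cos (r * t) * cos (sg + s * (r * t)) - s * (sin (r * t) * sin (sg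
  + s * (r * t)))).
pose d' t := v * r * (cos (r * t) * sin (sg + s * (r * t)) + s * (sin (r * t) * cos (sg
  + s * (r * t)))).
apply: (@arclength_curve T p _ _ _ _ a' b' c' d' T0 pS).
- move=> t; split.
  + refine (is_derive_congr (is_derive_add (is_derive_mul (Dcy t) (Dcs t))
    (is_derive_mul (is_derive_scal s (Dsy t)) (Dss t))) _).
    by rewrite /a' v2; ring.
  + refine (is_derive_congr (is_derive_sub (is_derive_mul (is_derive_scal s (Dsy t))
    (Dcs t)) (is_derive_mul (Dcy t) (Dss t))) _).
    by rewrite /b' v2; ring.
  + refine (is_derive_congr (is_derive_mul (is_derive_scal v (Dsy t)) (Dcz t)) _).
    by rewrite /c'; ring.
  + refine (is_derive_congr (is_derive_mul (is_derive_scal v (Dsy t)) (Dsz t)) _).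
    by rewrite /d'; ring.
- split; rewrite /endA /endB.
  + exact: (lipD (lipM T0 (lip_cos ly) (lip_cos lsy)) (lipM T0 (Z s _ (lip_sin ly))
    (lip_sin lsy))).
  + exact: (lipB (lipM T0 (Z s _ (lip_sin ly)) (lip_cos lsy)) (lipM T0 (lip_cos ly)
    (lip_sin lsy))).
  + exact: (lipM T0 (Z v _ (lip_sin ly)) (lip_cos lz)).
  + exact: (lipM T0 (Z v _ (lip_sin ly)) (lip_sin lz)).
- move=> t; rewrite /nrm2 end_norm -v2 !exprMn -addrA -mulrDr cos2Dsin2 mulr1; ring.
- move=> t; have [e1 e2] := end_twist s (r * t); have cz := cos2Dsin2 (sg + s * (r * t)).
  rewrite /a' /b' /c' /d'.
  (* By [end_twist] the first bracket is s sin (r t), the last is 1, and the two terms cancel. *)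
  transitivity (v ^+ 2 * r * sin (r * t) * (endA s (r * t) * sin (s * (r * t)) + endB s
    (r * t) * cos (s * (r * t)))
     - v ^+ 2 * r * sin (r * t) * s * sin (r * t) * (cos (sg + s * (r * t)) ^+ 2 + sin
       (sg + s * (r * t)) ^+ 2)).
    by ring.
  by rewrite e2 cz; ring.
- move=> t; have cz := cos2Dsin2 (sg + s * (r * t)); have cs := cos2Dsin2 (s * (r * t)).
  have cy := cos2Dsin2 (r * t).
  rewrite /a' /b' /c' /d'.
  transitivity (4 * (r ^+ 2 * v ^+ 2) * (v ^+ 2 * sin (r * t) ^+ 2 * (cos (s * (r * t))
    ^+ 2 + sin (s * (r * t)) ^+ 2)
    + (cos (r * t) ^+ 2 + s ^+ 2 * sin (r * t) ^+ 2) * (cos (sg + s * (r * t)) ^+ 2 +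
      sin (sg + s * (r * t)) ^+ 2))).
    by rewrite /nrm2; ring.
  by rewrite cs cz r2 v2 !mulr1 mul1r -[RHS]cy; ring.
Qed.

Lemma geo0 s sg : geo s sg 0 = 1%:M.
Proof.
by rewrite -qm1 /geo /endA /endB !mulr0 cos0 sin0; congr qm; ring.
Qed.

Lemma reach_mx0 h : SU2 h -> reach_mx h 0 -> h = 1%:M.
Proof.
move=> hS [s [x [hs hx aE bE /esym/eqP]]].
have [hE n] := SU2_coord hS.
have aa : cA h = 1 -> h = 1%:M.
  move=> a1; move: n; rewrite a1 /nrm2 expr1n -!addrA => /eqP.
  rewrite -subr_eq0 addrAC subrr add0r !paddr_eq0 ?addr_ge0 ?sqr_ge0 // !sqrf_eq0.
  by move=> /and3P[/eqP b0 /eqP c0 /eqP d0]; rewrite hE a1 b0 c0 d0 qm1.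
rewrite !mulf_eq0 pnatr_eq0 /= sqrtr_eq0 subr_le0 => /orP[/eqP x0|s1]; apply: aa.
  by rewrite aE x0 /endA mulr0 cos0 sin0; ring.
have : s ^+ 2 = 1.
  by apply/le_anti; rewrite s1 -(real_normK (num_real s)) expr_le1 // ler_norml hs.
move/eqP; rewrite sqrf_eq1 aE /endA => /orP[] /eqP ->.
  by rewrite !mul1r -!expr2 cos2Dsin2.
by rewrite !mulN1r cosN sinN mulrNN -!expr2 cos2Dsin2.
Qed.

(** By [end_norm] alpha already forces |beta| = sqrt (1 - s^2) sin x, so only the phase of beta must
    be matched: sg is that phase minus s x. *)
Lemma geo_end h s x : SU2 h -> cA h = endA s x -> cB h = endB s x -> -1 < s < 1 -> 0 <=
  x <= pi ->
  exists sg, geo s sg (2 * x * Num.sqrt (1 - s ^+ 2)) = h /\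
    geo s (sg + pi) (2 * x * Num.sqrt (1 - s ^+ 2)) = qm (cA h) (cB h) (- cC h) (- cD h).
Proof.
move=> hS aE bE s1 xpi; have [hE n] := SU2_coord hS.
have s3 : 0 < 1 - s ^+ 2.
  have : s ^+ 2 < 1 by rewrite -(real_normK (num_real s)) expr_lt1 // ltr_norml.
  by rewrite subr_gt0.
rewrite /geo; set v := Num.sqrt _.
have v2 : v ^+ 2 = 1 - s ^+ 2 by rewrite sqr_sqrtr // ltW.
have v0 : 0 < v by rewrite sqrtr_gt0.
have -> : (2 * v)^-1 * (2 * x * v) = x by field; rewrite gt_eqF.
have [p _ [cE dE]] := polar (cC h) (cD h).
have r : Num.sqrt (cC h ^+ 2 + cD h ^+ 2) = v * sin x.
  have -> : cC h ^+ 2 + cD h ^+ 2 = (v * sin x) ^+ 2.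
    rewrite exprMn v2; have := end_norm s x; rewrite -aE -bE; move: n; rewrite /nrm2; lra.
  by rewrite sqrtr_sqr ger0_norm // mulr_ge0 ?sin_ge0_pi // ltW.
rewrite r in cE dE.
exists (p - s * x); rewrite subrK.
have -> : p - s * x + pi + s * x = p + pi by ring.
by split; rewrite -?aE -?bE -?cE -?dE ?cosDpi ?sinDpi ?mulrN -?cE -?dE -?hE.
Qed.

Lemma reach_mx_param h l : 0 < l -> reach_mx h l -> exists s x, [/\ -1 < s < 1, 0 < x <= pi,
  cA h = endA s x, cB h = endB s x & l = 2 * x * Num.sqrt (1 - s ^+ 2)].
Proof.
move=> l0 [s [x [/andP[s1 s2] /andP[x0 xpi] aE bE lE]]]; exists s, x; split => //.
  have : Num.sqrt (1 - s ^+ 2) != 0.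
    by apply/eqP => e; move: l0; rewrite lE e mulr0 ltxx.
  rewrite sqrtr_eq0 -ltNge subr_gt0 -(real_normK (num_real s)) expr_lt1 //.
  by rewrite ltr_norml.
rewrite xpi andbT lt_neqAle x0 andbT; apply/eqP => e.
by move: l0; rewrite lE -e mulr0 mul0r ltxx.
Qed.

Lemma geodesic_ex p h l : SU2 p -> SU2 h -> reach_mx h l ->
  exists gam, [/\ horizontal l gam, gam 0 = p, gam l = p *m h, sr_length l gam = l%:E &
     0 < l -> forall t, pip (bodyvel gam t) (bodyvel gam t) = 1].
Proof.
move=> pS hS hl; have : 0 <= l by exact: reach_ge0 hl.
rewrite le_eqVlt => /orP[/eqP l0|l0].
  have h1 : h = 1%:M by apply: reach_mx0 => //; rewrite l0.
  have s0 : -1 < (0 : R) < 1 by apply/andP; split; lra.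
  have [H P S] := @geo_arclength 0 p 0 0 (lexx 0) pS s0.
  exists (fun t => p *m geo 0 0 t); rewrite -l0 !geo0 h1 mulmx1; split => //.
have [s [x [s1 /andP[x0 xpi] aE bE lE]]] := reach_mx_param l0 hl.
have [sg [e _]] := geo_end hS aE bE s1 ltac:(by rewrite (ltW x0)).
have [H P S] := @geo_arclength l p s sg (ltW l0) pS s1.
have gl : p *m geo s sg l = p *m h by rewrite lE e.
by exists (fun t => p *m geo s sg t); split => //; rewrite geo0 mulmx1.
Qed.

Lemma two_geodesics p h l : SU2 p -> SU2 h -> reach_mx h l -> 0 < l ->
  exists gam1 gam2 : R -> 'M[R]_4, [/\
    [/\ horizontal l gam1, gam1 0 = p, gam1 l = p *m h, sr_length l gam1 = l%:E &
     forall t, pip (bodyvel gam1 t) (bodyvel gam1 t) = 1],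
    [/\ horizontal l gam2, gam2 0 = p, gam2 l = p *m qm (cA h) (cB h) (- cC h) (- cD h),
     sr_length l gam2 = l%:E & forall t, pip (bodyvel gam2 t) (bodyvel gam2 t) = 1] &
    exists2 t, 0 <= t <= l & gam1 t <> gam2 t].
Proof.
move=> pS hS hl l0.
have [s [x [s1 /andP[x0 xpi] aE bE lE]]] := reach_mx_param l0 hl.
have [sg [e1 e2]] := geo_end hS aE bE s1 ltac:(by rewrite (ltW x0)).
have [H1 P1 S1] := @geo_arclength l p s sg (ltW l0) pS s1.
have [H2 P2 S2] := @geo_arclength l p s (sg + pi) (ltW l0) pS s1.
exists (fun t => p *m geo s sg t), (fun t => p *m geo s (sg + pi) t).
split; [by split => //; rewrite ?geo0 ?mulmx1 // lE e1|by split => //; rewrite ?geo0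
  ?mulmx1 // lE e2|].
(* At half time the angle is x / 2, in (0, pi / 2], where beta is nonzero and hence differs from its
   negative. *)
exists (l / 2); first by apply/andP; split; lra.
move=> /(congr1 (mulmx (invmx p))); rewrite !mulKmx ?SU2_unit //.
rewrite /geo lE; set v := Num.sqrt _.
have v0 : 0 < v.
  have := l0; rewrite lE -/v pmulr_rgt0 // mulr_gt0 //.
have -> : (2 * v)^-1 * (2 * x * v / 2) = x / 2 by field; rewrite gt_eqF.
case/qm_inj => _ _.
have -> : sg + pi + s * (x / 2) = sg + s * (x / 2) + pi by ring.
rewrite cosDpi sinDpi.
have sx : 0 < sin (x / 2).
  by apply: sin_gt0_pi; apply/andP; split; [rewrite divr_gt0|have := pi_gt0 R; lra].
have vs : v * sin (x / 2) != 0 by rewrite mulf_neq0 // gt_eqF.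
move=> /(mulfI vs) e3 /(mulfI vs) e4.
have := cos2Dsin2 (sg + s * (x / 2)).
have -> : cos (sg + s * (x / 2)) = 0 by lra.
have -> : sin (sg + s * (x / 2)) = 0 by lra.
by rewrite expr0n /= addr0 => /eqP; rewrite eq_sym oner_eq0.
Qed.

Lemma reach_mx_ex h : SU2 h -> exists l, reach_mx h l.
Proof.
move=> /SU2_coord[_ n]; apply: reach_surj; rewrite -n /nrm2 -addrA lerDl.
by rewrite addr_ge0 ?sqr_ge0.
Qed.

Lemma reach_mx_inv h l : SU2 h -> reach_mx h l -> reach_mx (invmx h) l.
Proof.
move=> /SU2P[a [b [c [d [n ->]]]]]; rewrite (qm_inv n) /reach_mx !coord_qm; exact: reachN.
Qed.

(** Conjugation by an element of [Id] fixes or conjugates the first entry, and [reachN] covers the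
    latter. *)
Lemma reach_mx_conj q h l : id_class q -> SU2 h -> reach_mx h l -> reach_mx (invmx q *m
  h *m q) l.
Proof.
move=> hq /SU2P[a [b [c [d [n ->]]]]] hr.
have e1 (q0 q3 : R) : q = qm q0 0 0 q3 -> q0 ^+ 2 + q3 ^+ 2 = 1 ->
  invmx q *m qm a b c d *m q = qm a (b * (q0 ^+ 2 - q3 ^+ 2) + 2 * q0 * q3 * c) (c *
    (q0 ^+ 2 - q3 ^+ 2) - 2 * q0 * q3 * b) d.
  move=> -> e; rewrite qm_inv; last by rewrite /nrm2 -e; ring.
  rewrite !qmM; congr qm; try ring.
  - by rewrite -[RHS]mulr1 -e; ring.
  - by rewrite -[RHS]mulr1 -e; ring.
move: hr; rewrite /reach_mx !coord_qm => hr.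
have key (q0 q3 : R) : q = qm q0 0 0 q3 -> q0 ^+ 2 + q3 ^+ 2 = 1 ->
  [/\ (q0 ^+ 2 - q3 ^+ 2 = 1) \/ (q0 ^+ 2 - q3 ^+ 2 = -1) & 2 * q0 * q3 = 0] ->
  reach (cA (invmx q *m qm a b c d *m q)) (cB (invmx q *m qm a b c d *m q)) l.
  move=> qE e [e2 e3]; rewrite (e1 _ _ qE e) e3 !coord_qm mul0r addr0.
  by case: e2 => ->; rewrite ?mulr1 ?mulrN1 //; exact: reachN.
case: hq => qE; apply: (key _ _ qE); rewrite ?sqrrN ?expr1n ?expr0n /= ?addr0 ?add0r
  ?subr0 ?sub0r //;
  (split; [by [left|right]|ring]).
Qed.

Lemma sr_dist_reach (x y : 'M[R]_4) l : SU2 x -> SU2 y -> reach_mx (invmx x *m y) l ->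
  sr_dist x y = l%:E.
Proof.
move=> xS yS hr; apply/le_anti/andP; split.
  have [gam [H g0 gl len _]] := geodesic_ex xS (SU2M (SU2V xS) yS) hr.
  apply: ereal_inf_lbound; exists l, gam; split => //.
  by rewrite gl mulKVmx // SU2_unit.
by apply: le_ereal_inf_tmp => _ [T [gam [H g0 gT ->]]]; apply: length_ge => //; rewrite
  g0 gT.
Qed.

(** Different pairs (s, x) may give the same entry; each length is the distance from 1 to h. *)
Lemma reach_mx_unique h l l' : SU2 h -> reach_mx h l -> reach_mx h l' -> l = l'.
Proof.
move=> hS h1 h2.
have e (m : R) : reach_mx h m -> sr_dist 1%:M h = m%:E.
  move=> hm; apply: sr_dist_reach => //; first exact: SU21.
  by rewrite -[invmx 1%:M]mulmx1 mulVmx ?unitmx1 // mul1mx.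
by have := e l h1; rewrite (e l' h2) => -[].
Qed.

End Fin.

(** * The cut locus *)

Section Main.
Variable R : realType.
Notation mu := (@lebesgue_measure R).
Implicit Types (f : R -> R) (T : R) (gam : R -> 'M[R]_4) (g h p q : 'M[R]_4).

Lemma SU2_invmxM g h : SU2 g -> SU2 h -> invmx (g *m h) = invmx h *m invmx g.
Proof. by move=> gS hS; exact: (@invrM _ (g : 'M[R]_4) h (SU2_unit gS) (SU2_unit hS)). Qed.

Lemma lequiv_refl g : SU2 g -> lequiv g g.
Proof. by move=> gS; apply/lequivP; split => //; exists 1%:M; [exact:
  id_class_id|rewrite mulmx1]. Qed.

Lemma lequiv_sym g h : lequiv g h -> lequiv h g.
Proof.
move=> /lequivP[gS [q qc ->]]; apply/lequivP; split; first by apply: SU2M => //; exact: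
  id_class_SU2.
by exists (invmx q); [exact: id_classV|rewrite mulmxK // SU2_unit //; exact: id_class_SU2].
Qed.

Lemma lequiv_trans g h p : lequiv g h -> lequiv h p -> lequiv g p.
Proof.
move=> /lequivP[gS [q qc ->]] /lequivP[_ [q' qc' ->]]; apply/lequivP; split => //.
by exists (q *m q'); [exact: id_classM|rewrite mulmxA].
Qed.

Lemma lequiv_mulr g q : SU2 g -> id_class q -> lequiv g (g *m q).
Proof. by move=> gS qc; apply/lequivP; split => //; exists q. Qed.

Lemma lequiv_SU2 g h : lequiv g h -> SU2 g /\ SU2 h.
Proof. by move=> e; split; [case/lequivP: e|case/lequivP: (lequiv_sym e)]. Qed.

Lemma lequiv_Id g : lequiv g (Id4 R) <-> id_class g.
Proof.
rewrite Id4E qm1; split=> [e|gc].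
  by have /lequivP[_ [q qc ->]] := lequiv_sym e; rewrite mul1mx.
by apply: lequiv_sym; rewrite -[X in lequiv _ X]mul1mx; apply: lequiv_mulr => //;
  exact: SU21.
Qed.

Lemma lhat_dist_equiv g h : lequiv g h -> lhat_dist (Id4 R) g = lhat_dist (Id4 R) h.
Proof.
move=> e; rewrite /lhat_dist; congr ereal_inf; apply/seteqP.
split=> _ [T [gam [H g0 gT ->]]]; exists T, gam; split => //.
  exact: lequiv_trans gT e.
exact: lequiv_trans gT (lequiv_sym e).
Qed.

Lemma lhat_dist_le g x l : SU2 g -> id_class x -> reach_mx (invmx x *m g) l ->
  (lhat_dist (Id4 R) g <= l%:E)%E.
Proof.
move=> gS xc hr; have xS := id_class_SU2 xc.
have [gam [H g0 gl len _]] := geodesic_ex xS (SU2M (SU2V xS) gS) hr.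
apply: ereal_inf_lbound; exists l, gam; split => //.
- by rewrite g0; apply/lequiv_Id.
- by rewrite gl mulKVmx ?SU2_unit //; exact: lequiv_refl.
Qed.

(** Moves q from the end point to the starting point: (x q^{-1})^{-1} g is the conjugate of x^{-1} g
    q by q^{-1}. *)
Lemma reach_mx_change g x q l : SU2 g -> id_class x -> id_class q ->
  reach_mx (invmx x *m (g *m q)) l -> reach_mx (invmx (x *m invmx q) *m g) l.
Proof.
move=> gS xc qc hr.
have xS := id_class_SU2 xc; have qS := id_class_SU2 qc.
have := reach_mx_conj (id_classV qc) (SU2M (SU2V xS) (SU2M gS qS)) hr.
by rewrite (SU2_invmxM xS (SU2V qS)) !mulmxA mulmxK // SU2_unit.
Qed.

Lemma lhat_dist_ge g l : SU2 g ->
  (forall x l', id_class x -> reach_mx (invmx x *m g) l' -> l <= l') ->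
  (l%:E <= lhat_dist (Id4 R) g)%E.
Proof.
move=> gS hmin; apply: le_ereal_inf_tmp => _ [T [gam [H g0 gT ->]]].
move: g0 => /lequiv_Id g0.
have /lequivP[_ [q qc gE]] := lequiv_sym gT.
have [_ gTS] := lequiv_SU2 (lequiv_sym gT).
have [l' hl'] := reach_mx_ex (SU2M (SU2V (id_class_SU2 g0)) gTS).
apply: le_trans (length_ge H hl'); rewrite lee_fin.
rewrite gE in hl'; apply: hmin (reach_mx_change gS g0 qc hl').
by apply: id_classM => //; exact: id_classV.
Qed.

Lemma nearest_in_id_class g : SU2 g -> exists x l, [/\ id_class x, reach_mx (invmx x *m
  g) l &
  forall x' l', id_class x' -> reach_mx (invmx x' *m g) l' -> l <= l'].
Proof.
move=> gS.
have S x : id_class x -> SU2 (invmx x *m g) by move=> xc; exact: SU2M (SU2V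
  (id_class_SU2 xc)) gS.
have c1 : id_class (qm 1 0 0 0 : 'M[R]_4) by constructor 1.
have c2 : id_class (qm (-1) 0 0 0 : 'M[R]_4) by constructor 2.
have c3 : id_class (qm 0 0 0 1 : 'M[R]_4) by constructor 3.
have c4 : id_class (qm 0 0 0 (-1) : 'M[R]_4) by constructor 4.
have [l1 h1] := reach_mx_ex (S _ c1); have [l2 h2] := reach_mx_ex (S _ c2).
have [l3 h3] := reach_mx_ex (S _ c3); have [l4 h4] := reach_mx_ex (S _ c4).
have two (x y : 'M[R]_4) (lx ly : R) : exists z lz, [/\ z = x /\ lz = lx \/ z = y /\ lz
  = ly, lz <= lx & lz <= ly].
  case: (leP lx ly) => h; [exists x, lx|exists y, ly]; split => //; [by left|by
    right|exact: ltW].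
have [z [lz [zE z1 z2]]] := two (qm 1 0 0 0) (qm (-1) 0 0 0) l1 l2.
have [w [lw [wE w3 w4]]] := two (qm 0 0 0 1) (qm 0 0 0 (-1)) l3 l4.
have [m [lm [mE mz mw]]] := two z w lz lw.
exists m, lm.
have [mc mr] : id_class m /\ reach_mx (invmx m *m g) lm.
  by case: mE => -[-> ->]; [case: zE|case: wE] => -[-> ->].
split => // x' l' x'c hx'.
have U x lx : id_class x -> reach_mx (invmx x *m g) lx -> x' = x -> l' = lx.
  by move=> xc hx e; rewrite e in hx'; exact: reach_mx_unique (S _ xc) hx' hx.
case: (x'c) => e.
- by rewrite (U _ _ c1 h1 e) (le_trans mz).
- by rewrite (U _ _ c2 h2 e) (le_trans mz).
- by rewrite (U _ _ c3 h3 e) (le_trans mw).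
- by rewrite (U _ _ c4 h4 e) (le_trans mw).
Qed.

Lemma horizontal_lip T gam : horizontal T gam ->
  [/\ lip T (fun t => cA (gam t)), lip T (fun t => cB (gam t)),
      lip T (fun t => cC (gam t)) & lip T (fun t => cD (gam t))].
Proof. by move=> /horizontal_length[L [[_ [[]]]]]. Qed.

(** Uniqueness of lifts. Where gam2 = gam1 q, the inner product of the two is the real part of q: 1
    if q = 1, at most 0 otherwise. Being continuous, it cannot leave the value 1 without passing
    through 1 / 2. *)
Lemma lequiv_eq T gam1 gam2 u : horizontal T gam1 -> horizontal T gam2 ->
  0 <= u <= T -> gam1 u = gam2 u ->
  (forall t, 0 <= t <= T -> lequiv (gam1 t) (gam2 t)) ->
  forall t, 0 <= t <= T -> gam1 t = gam2 t.
Proof.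
move=> H1 H2 hu eu heq.
have T0 := H1.1.
have [la lb lc ld] := horizontal_lip H1; have [la' lb' lc' ld'] := horizontal_lip H2.
pose f t := cA (gam1 t) * cA (gam2 t) + cB (gam1 t) * cB (gam2 t) +
  cC (gam1 t) * cC (gam2 t) + cD (gam1 t) * cD (gam2 t).
have lf : lip T f.
  exact: (lipD (lipD (lipD (lipM T0 la la') (lipM T0 lb lb')) (lipM T0 lc lc')) (lipM
    T0 ld ld')).
have fv t : 0 <= t <= T -> gam1 t = gam2 t \/ f t <= 0.
  move=> ht; have /lequivP[gS [q qc e]] := heq t ht.
  rewrite /f e; have [gE n] := SU2_coord gS; rewrite gE in n *.
  case: qc => ->; rewrite qmM !coord_qm.
  - by left; congr qm; ring.
  - right; rewrite -[leRHS]add0r -subr_le0; have := n; rewrite /nrm2 !coord_qm; lra.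
  - by right; rewrite le_eqVlt; apply/orP; left; apply/eqP; ring.
  - by right; rewrite le_eqVlt; apply/orP; left; apply/eqP; ring.
have fu : f u = 1.
  rewrite /f -eu; have [_ n] := SU2_coord (H1.2.1 u hu); rewrite -n /nrm2; ring.
have cf := lip_clamp_continuous T0 lf.
have clE t : 0 <= t <= T -> clamp T t = t.
  by move=> /andP[t0 tT]; rewrite /clamp min_r // max_r.
move=> t ht; case: (fv t ht) => // ft; exfalso.
have half c : 0 <= c <= T -> f c = 1 / 2 -> False.
  move=> hc fc; case: (fv c hc) => [e|]; last by rewrite fc; lra.
  move: fc; rewrite /f -e; have [_ n] := SU2_coord (H1.2.1 c hc).
  by move: n; rewrite /nrm2; lra.
have [tu|ut] := leP t u.
  have [||c + fc] := @IVT R (fun s => f (clamp T s)) t u (1 / 2) tu.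
  - exact: continuous_subspaceT.
  - by rewrite !clE // fu ge_min le_max; apply/andP; split; apply/orP; [left|right]; lra.
  rewrite in_itv /= => /andP[tc cu].
  have hc : 0 <= c <= T by move: ht hu => /andP[? ?] /andP[? ?]; apply/andP; split; lra.
  by apply: (half c hc); rewrite clE in fc.
have [||c + fc] := @IVT R (fun s => f (clamp T s)) u t (1 / 2) (ltW ut).
- exact: continuous_subspaceT.
- by rewrite !clE // fu ge_min le_max; apply/andP; split; apply/orP; [right|left]; lra.
rewrite in_itv /= => /andP[tc cu].
have hc : 0 <= c <= T by move: ht hu => /andP[? ?] /andP[? ?]; apply/andP; split; lra.
by apply: (half c hc); rewrite clE in fc.
Qed.

Lemma min_geod_intro g x l gam : 0 < l -> id_class x -> SU2 g -> lequiv (gam l) g ->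
  (lhat_dist (Id4 R) g = l%:E)%E ->
  horizontal l gam -> gam 0 = x -> sr_length l gam = l%:E ->
  (forall t, pip (bodyvel gam t) (bodyvel gam t) = 1) ->
  min_geod_from_Id l gam.
Proof.
move=> l0 xc gS e hl H g0 len P; split => //.
- by rewrite g0; apply/lequiv_Id.
- by apply: aeW => t _; exact: P.
- by rewrite len (lhat_dist_equiv e).
Qed.

Lemma K_sym_cut g : SU2 g -> K_sym g -> cut_locus g.
Proof.
move=> gS [x1 [x2 [/lequiv_Id c1 /lequiv_Id c2 x12 e hmin]]].
have S1 := id_class_SU2 c1; have S2 := id_class_SU2 c2.
have S x : SU2 x -> SU2 (invmx x *m g) by move=> xS; exact: SU2M (SU2V xS) gS.
(* [K_sym] measures from g to x, while curves start at x; inverting x^{-1} g keeps the length. *)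
have dE x l : SU2 x -> reach_mx (invmx x *m g) l -> sr_dist g x = l%:E.
  move=> xS /(reach_mx_inv (S x xS)) h; apply: sr_dist_reach => //.
  by have := SU2_invmxM (SU2V xS) gS; rewrite invmxK => <-.
have [l h1] := reach_mx_ex (S _ S1); have [l2 h2] := reach_mx_ex (S _ S2).
have {}e : l = l2 by move: e; rewrite (dE _ _ S1 h1) (dE _ _ S2 h2) => -[].
subst l2.
have l0 : 0 < l.
  have := reach_ge0 h1; rewrite le_eqVlt => /orP[/eqP l0|//].
  rewrite -l0 in h1 h2; case: x12.
  have := reach_mx0 (S _ S1) h1; rewrite -(reach_mx0 (S _ S2) h2).
  move=> /(congr1 (fun y => y *m invmx g)); rewrite !mulmxK ?SU2_unit //.
  by move=> /(congr1 invmx); rewrite !invmxK.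
have hl : lhat_dist (Id4 R) g = l%:E.
  apply/le_anti; rewrite (lhat_dist_le gS c1 h1) /=; apply: lhat_dist_ge => // x l' xc hx.
  have := hmin x ltac:(by apply/lequiv_Id).
  by rewrite (dE _ _ S1 h1) (dE _ _ (id_class_SU2 xc) hx) lee_fin.
have [gam1 [H1 g10 g1l len1 P1]] := geodesic_ex S1 (S _ S1) h1.
have [gam2 [H2 g20 g2l len2 P2]] := geodesic_ex S2 (S _ S2) h2.
rewrite mulKVmx ?SU2_unit // in g1l; rewrite mulKVmx ?SU2_unit // in g2l.
have e1 : lequiv (gam1 l) g by rewrite g1l; exact: lequiv_refl.
have e2 : lequiv (gam2 l) g by rewrite g2l; exact: lequiv_refl.
exists l; split; first exact: l0.
exists gam1, gam2; split; [| |exact: e1|exact: e2|].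
- exact: (min_geod_intro l0 c1 gS e1 hl H1 g10 len1 (P1 l0)).
- exact: (min_geod_intro l0 c2 gS e2 hl H2 g20 len2 (P2 l0)).
apply: contrapT => hs; apply: x12; rewrite -g10 -g20.
(* The lifts share their end point g, so equal projections would give equal starting points. *)
apply: (lequiv_eq H1 H2 (u := l)); rewrite ?lexx ?ltW //; first by rewrite g1l g2l.
by move=> t ht; apply: contrapT => h; apply: hs; exists t.
Qed.

Lemma K_loc_cut g : SU2 g -> K_loc g -> cut_locus g.
Proof.
move=> gS [[t ge] gn]; move: ge; rewrite expm_kk.
set C := cos _; set S := sin _ => ge.
have CS : C ^+ 2 + S ^+ 2 = 1 by exact: cos2Dsin2.
set g0 := qm C S 0 0 in ge.
have g0S : SU2 g0 by case: (lequiv_SU2 ge).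
have [x [l [xc hx hmin]]] := nearest_in_id_class g0S.
have xS := id_class_SU2 xc; have hS := SU2M (SU2V xS) g0S.
have l0 : 0 < l.
  have := reach_ge0 hx; rewrite le_eqVlt => /orP[/eqP l0|//].
  case: gn; apply: (lequiv_trans ge); apply/lequiv_Id.
  rewrite -l0 in hx; have := reach_mx0 hS hx.
  by move=> /(congr1 (mulmx x)); rewrite mulKVmx ?SU2_unit // mulmx1 => ->.
have hl : lhat_dist (Id4 R) g0 = l%:E.
  by apply/le_anti; rewrite (lhat_dist_le g0S xc hx) /=; exact: lhat_dist_ge.
have [gam1 [gam2 [[H1 g10 g1l len1 P1] [H2 g20 g2l len2 P2] [s hs ns]]]] :=
  two_geodesics xS hS hx l0.
rewrite mulKVmx ?SU2_unit // in g1l.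
have e1 : lequiv (gam1 l) g0 by rewrite g1l; exact: lequiv_refl.
(* If x is 1 or -1, then x^{-1} g0 has beta = 0 and the end point is unchanged. For the other two x
   it has alpha = 0, and the end point becomes -g0, still in the class. *)
have e2 : lequiv (gam2 l) g0.
  have c1 : id_class (qm 1 0 0 0 : 'M[R]_4) by constructor 1.
  have c2 : id_class (qm (-1) 0 0 0 : 'M[R]_4) by constructor 2.
  have n1 : nrm2 1 0 0 0 = 1 :> R by rewrite /nrm2; ring.
  have n2 : nrm2 (-1) 0 0 0 = 1 :> R by rewrite /nrm2; ring.
  have n3 : nrm2 0 0 0 1 = 1 :> R by rewrite /nrm2; ring.
  have n4 : nrm2 0 0 0 (-1) = 1 :> R by rewrite /nrm2; ring.
  apply: lequiv_sym; rewrite g2l; case: xc => ->.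
  - have -> : qm 1 0 0 0 *m qm (cA (invmx (qm 1 0 0 0) *m g0)) (cB (invmx (qm 1 0 0 0)
    *m g0))
      (- cC (invmx (qm 1 0 0 0) *m g0)) (- cD (invmx (qm 1 0 0 0) *m g0)) = g0 *m qm 1
        0 0 0.
      by rewrite (qm_inv n1) /g0 !qmM !coord_qm; congr qm; ring.
    exact: lequiv_mulr.
  - have -> : qm (-1) 0 0 0 *m qm (cA (invmx (qm (-1) 0 0 0) *m g0)) (cB (invmx (qm
    (-1) 0 0 0) *m g0))
      (- cC (invmx (qm (-1) 0 0 0) *m g0)) (- cD (invmx (qm (-1) 0 0 0) *m g0)) = g0 *m
        qm 1 0 0 0.
      by rewrite (qm_inv n2) /g0 !qmM !coord_qm; congr qm; ring.
    exact: lequiv_mulr.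
  - have -> : qm 0 0 0 1 *m qm (cA (invmx (qm 0 0 0 1) *m g0)) (cB (invmx (qm 0 0 0 1)
    *m g0))
      (- cC (invmx (qm 0 0 0 1) *m g0)) (- cD (invmx (qm 0 0 0 1) *m g0)) = g0 *m qm
        (-1) 0 0 0.
      by rewrite (qm_inv n3) /g0 !qmM !coord_qm; congr qm; ring.
    exact: lequiv_mulr.
  - have -> : qm 0 0 0 (-1) *m qm (cA (invmx (qm 0 0 0 (-1)) *m g0)) (cB (invmx (qm 0 0
    0 (-1)) *m g0))
      (- cC (invmx (qm 0 0 0 (-1)) *m g0)) (- cD (invmx (qm 0 0 0 (-1)) *m g0)) = g0 *m
        qm (-1) 0 0 0.
      by rewrite (qm_inv n4) /g0 !qmM !coord_qm; congr qm; ring.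
    exact: lequiv_mulr.
exists l; split; first exact: l0.
exists gam1, gam2; split.
- exact: (min_geod_intro l0 xc g0S e1 hl H1 g10 len1 P1).
- exact: (min_geod_intro l0 xc g0S e2 hl H2 g20 len2 P2).
- exact: lequiv_trans e1 (lequiv_sym ge).
- exact: lequiv_trans e2 (lequiv_sym ge).
apply: contrapT => h; apply: ns.
apply: (lequiv_eq H1 H2 (u := 0)) => //; [by rewrite lexx ltW|by rewrite g10 g20|].
by move=> v hv; apply: contrapT => h'; apply: h; exists v.
Qed.

(** The lift is moved by q to end at g itself, then translated to start at 1. Minimality in L(4,1)
    bounds t by the distance from every point of [Id] to g; [hcurve_lower] gives the reverse bound
    for x. *)
Lemma min_geod_normal t gam g : 0 < t -> SU2 g -> min_geod_from_Id t gam -> lequiv (gam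
  t) g ->
  exists x q, [/\ id_class x /\ id_class q, gam 0 *m q = x, gam t *m q = g, reach_mx
    (invmx x *m g) t &
   (forall x' l, id_class x' -> reach_mx (invmx x' *m g) l -> t <= l) /\
   hcurve_mx t (fun s => invmx x *m (gam s *m q)) id].
Proof.
move=> t0 gS [H /lequiv_Id yc h1 len] /lequivP[gtS [q qc gE]].
have [hc tlen] := arclength_hcurve_mx H h1.
have qS := id_class_SU2 qc; have yS := id_class_SU2 yc.
have xc : id_class (gam 0 *m q) by exact: id_classM.
have xS := id_class_SU2 xc.
have hmin x' l : id_class x' -> reach_mx (invmx x' *m g) l -> t <= l.
  move=> x'c hx'; rewrite gE in hx'.
  have c : id_class (x' *m invmx q) by apply: id_classM => //; exact: id_classV.
  have := lhat_dist_le gtS c (reach_mx_change gtS x'c qc hx'); rewrite -len.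
  by move=> /(le_trans tlen); rewrite lee_fin.
have hc' := hcurve_mx_left (ltW t0) (SU2V xS) (hcurve_mx_right (ltW t0) qc hc).
exists (gam 0 *m q), q; split => //.
have [l hl] := reach_mx_ex (SU2M (SU2V xS) gS).
suff -> : t = l by [].
apply/le_anti; rewrite (hmin _ _ xc hl) /=.
have b0 : invmx (gam 0 *m q) *m (gam 0 *m q) = qm 1 0 0 0 by rewrite mulVmx ?qm1 //
  SU2_unit.
apply: (hcurve_lower (ltW t0) hc'.2) => //.
- by rewrite b0 coord_qm.
- by rewrite b0 coord_qm.
- by rewrite -gE.
Qed.

Lemma cut_locus_cases g : SU2 g -> cut_locus g -> K_loc g \/ K_sym g.
Proof.
move=> gS [t [t0 [gam1 [gam2 [m1 m2 e1 e2 [s [hs ns]]]]]]].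
have [x1 [q1 [[xc1 qc1] x1E g1E r1 [min1 hc1]]]] := min_geod_normal t0 gS m1 e1.
have [x2 [q2 [[xc2 qc2] x2E g2E r2 [min2 hc2]]]] := min_geod_normal t0 gS m2 e2.
have S x : SU2 x -> SU2 (invmx x *m g) by move=> xS; exact: SU2M (SU2V xS) gS.
have dE x l : SU2 x -> reach_mx (invmx x *m g) l -> sr_dist g x = l%:E.
  move=> xS /(reach_mx_inv (S x xS)) h; apply: sr_dist_reach => //.
  by have := SU2_invmxM (SU2V xS) gS; rewrite invmxK => <-.
have xS1 := id_class_SU2 xc1; have xS2 := id_class_SU2 xc2.
have [x12|x12] := pselect (x1 = x2); last first.
  right; exists x1, x2; split => //; [exact/lequiv_Id|exact/lequiv_Id| |].
    by rewrite (dE _ _ xS1 r1) (dE _ _ xS2 r2).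
  move=> xs /lequiv_Id xsc; have [l hl] := reach_mx_ex (S _ (id_class_SU2 xsc)).
  by rewrite (dE _ _ xS1 r1) (dE _ _ (id_class_SU2 xsc) hl) lee_fin; exact: min1 hl.
left; rewrite -x12 in x2E hc2 r2.
set h := invmx x1 *m g in r1.
have hS : SU2 h by exact: S.
have gh : g = x1 *m h by rewrite mulKVmx // SU2_unit.
split; last first.
  (* Were g in [Id], it would be at distance 0 from [Id], whereas the minimum t is positive. *)
  move=> /lequiv_Id gc; have := min1 g 0 gc; rewrite mulVmx ?SU2_unit // => /(_ _) h0.
  suff : t <= 0 by rewrite leNgt t0.
  apply: h0; exists 0, 0; rewrite -qm1 !coord_qm /endA /endB !mulr0 cos0 sin0 lexx pi_ge0.
  by split => //; [apply/andP; split; lra|ring|ring|ring].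
have [a [X [s1 /andP[X0 Xpi] aE bE tE]]] := reach_mx_param t0 r1.
move: Xpi; rewrite le_eqVlt => /orP[/eqP Xpi|Xpi].
  have [hE n] := SU2_coord hS.
  have ab1 : cA h ^+ 2 + cB h ^+ 2 = 1 by rewrite aE bE end_norm Xpi sinpi expr0n /=
    mulr0 subr0.
  have [c0 d0] : cC h = 0 /\ cD h = 0.
    move: n; rewrite /nrm2 ab1 -addrA => /eqP; rewrite -subr_eq0 addrAC subrr add0r.
    by rewrite paddr_eq0 ?sqr_ge0 // !sqrf_eq0 => /andP[/eqP-> /eqP->].
  rewrite c0 d0 in hE.
  have [th _ [ca sb]] := circle_angle ab1.
  have key (e : R) (q : 'M[R]_4) : id_class q -> x1 *m h *m q = qm (cos (e / 2)) (sin
    (e / 2)) 0 0 ->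
     exists t0, lequiv g (expm (t0 *: kk R)).
    move=> qc qE; exists e; rewrite expm_kk -qE gh; apply: lequiv_mulr => //.
    by rewrite -gh.
  (* The factor is the inverse of x1: conjugation by x1 fixes e^{tk} if x1 is 1 or -1 and inverts it
     otherwise, hence the angle - th. *)
  case: (xc1) => xE.
  - apply: (key (2 * th) (qm 1 0 0 0)); first by constructor 1.
    have -> : 2 * th / 2 = th by field.
    by rewrite xE hE !qmM ca sb; congr qm; ring.
  - apply: (key (2 * th) (qm (-1) 0 0 0)); first by constructor 2.
    have -> : 2 * th / 2 = th by field.
    by rewrite xE hE !qmM ca sb; congr qm; ring.
  - apply: (key (- (2 * th)) (qm 0 0 0 (-1))); first by constructor 4.
    have -> : - (2 * th) / 2 = - th by field.
    by rewrite cosN sinN xE hE !qmM ca sb; congr qm; ring.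
  - apply: (key (- (2 * th)) (qm 0 0 0 1)); first by constructor 3.
    have -> : - (2 * th) / 2 = - th by field.
    by rewrite cosN sinN xE hE !qmM ca sb; congr qm; ring.
(* For X < pi the two lifts, normalised to run from 1 to h, coincide; the given curves then differ
   by elements of [Id] at every time. *)
exfalso; apply: ns.
have b1 : invmx x1 *m (gam1 0 *m q1) = qm 1 0 0 0 by rewrite x1E mulVmx ?qm1 // SU2_unit.
have b2 : invmx x1 *m (gam2 0 *m q2) = qm 1 0 0 0 by rewrite x2E mulVmx ?qm1 // SU2_unit.
have a1 : -1 <= a <= 1 by case/andP: s1 => ? ?; rewrite !ltW.
have X0' : 0 < X < pi by rewrite X0.
have := hcurve_unique t0 hc1.2 hc2.2; rewrite b1 b2 g1E g2E !coord_qm.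
move=> /(_ _ _ erefl erefl erefl erefl aE bE a1 X0' tE erefl erefl erefl erefl s hs)
  [ea eb ec ed].
have eh : invmx x1 *m (gam1 s *m q1) = invmx x1 *m (gam2 s *m q2).
  have [-> _] := SU2_coord (hc1.1 s hs); have [-> _] := SU2_coord (hc2.1 s hs).
  by rewrite ea eb ec ed.
have {}eh : gam1 s *m q1 = gam2 s *m q2.
  by move: eh => /(congr1 (mulmx x1)); rewrite !mulKVmx // SU2_unit.
have s1S : SU2 (gam1 s) by case: m1 => -[_ [+ _]] _ _ _; apply.
have s2S : SU2 (gam2 s) by case: m2 => -[_ [+ _]] _ _ _; apply.
apply: lequiv_trans (lequiv_mulr s1S qc1) _; rewrite eh.
by apply: lequiv_sym; exact: lequiv_mulr.
Qed.

End Main.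

Theorem theorem4 (R : realType) (g : 'M[R]_4) :
  SU2 g -> (cut_locus g <-> K_loc g \/ K_sym g).
Proof.
move=> gS; split; first exact: cut_locus_cases.
by case; [exact: K_loc_cut|exact: K_sym_cut].
Qed.
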